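(* Let $\mathcal Q_2$ be the twelve-dimensional real vector space of planar polynomial vector fields of degree at most two, let $X_\lambda$ ($\lambda\in\mathbb R^5$) be the five-parameter family of quadratic vector fields given in the context, and let $X_0$ be its member at $\lambda=0$. There are neighborhoods $\mathcal G$ of $(\mathrm{id},1)$ in $\mathrm{Aff}(2)\times\mathbb R_{>0}$, $\Lambda_0$ of $0$ in $\mathbb R^5$, and $\mathcal V_0$ of $X_0$ in $\mathcal Q_2$ such that $$\mathcal S(\Phi,\rho,\lambda)=\rho\,\Phi^*X_\lambda$$ is a real-analytic diffeomorphism from $\mathcal G\times\Lambda_0$ onto $\mathcal V_0$. In particular, every quadratic vector field sufficiently close to $X_0$ has a unique representation $\rho\,\Phi^*X_\lambda$ with $\Phi$ close to the identity, $\rho>0$ close to one, and all five coordinates of $\lambda$ free. The representation preserves oriented periodic orbits and their Poincar\'e multiplicities; that is, $\Phi$ maps oriented periodic orbits of $\rho\,\Phi^*X_\lambda$ to oriented periodic orbits of $X_\lambda$, with the same multiplicity.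
   Context: $\mathcal Q_2$ is the space of vector fields $Y=P(x,y)\partial_x+Q(x,y)\partial_y$ with $\deg P,\deg Q\le2$. For $\lambda=(B,\mu_2,\mu_3,\mu_4,\mu_5)\in\mathbb R^5$, $X_\lambda$ is $$\dot x=-y+Bx^2+\mu_2y^2+(\mu_4+B\mu_5)x,\qquad \dot y=x+xy+\mu_3y^2+(1-2B)\mu_5y,$$ so $X_0$ is $\dot x=-y$, $\dot y=x+xy$. $\mathrm{Aff}(2)$ is the group of invertible affine maps of $\mathbb R^2$ (six-dimensional). The pullback convention is $(\Phi^*Y)(z)=D\Phi(z)^{-1}Y(\Phi(z))$, $z=(x,y)$, and $\rho>0$ multiplies the field by a positive constant. The multiplicity of a periodic orbit is the order of vanishing of $P(s)-s$ at the corresponding fixed point, where $P$ is the Poincar\'e return map on an analytic transverse section. *)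

(* Defs.v *)
From HB Require Import structures.
From mathcomp Require Import all_boot all_order all_algebra.
From mathcomp Require Import ring lra.
From mathcomp Require Import all_classical all_reals all_analysis.

Set Implicit Arguments.
Unset Strict Implicit.
Unset Printing Implicit Defensive.

Import Order.TTheory GRing.Theory Num.Theory.
Import numFieldNormedType.Exports.

Local Open Scope classical_set_scope.
Local Open Scope ring_scope.

Definition multi_power {R : realType} {n : nat} (t : 'rV[R]_n)
    (alpha : {ffun 'I_n -> nat}) : R :=
  \prod_(i < n) t 0 i ^+ alpha i.

(* Sum over the finite box of multi-indices with all entries < N. *)
Definition box_sum {R : realType} {n : nat} {W : normedModType R}
    (a : {ffun 'I_n -> nat} -> W) (N : nat) : W :=
  \sum_(k : {ffun 'I_n -> 'I_N}) a [ffun i => k i : nat].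

(* Near a, f is the sum of an absolutely convergent power series in the linear
   coordinates t attached to a basis e of the (finite-dimensional) domain; the
   property does not depend on the basis. *)
Definition analytic_at {R : realType} {V W : normedModType R}
    (f : V -> W) (a : V) : Prop :=
  exists (n : nat) (e : 'I_n -> V) (c : {ffun 'I_n -> nat} -> W) (r : R),
    [/\ bijective (fun t : 'rV[R]_n => \sum_(i < n) t 0 i *: e i),
        0 < r &
        forall t : 'rV[R]_n, (forall i, `|t 0 i| < r) ->
          cvgn (box_sum (fun alpha => `|multi_power t alpha *: c alpha|)) /\
          box_sum (fun alpha => multi_power t alpha *: c alpha) @ \oo
            --> f (a + \sum_(i < n) t 0 i *: e i)].

Definition analytic_on {R : realType} {V W : normedModType R}
    (U : set V) (f : V -> W) : Prop :=
  forall a, U a -> analytic_at f a.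

Definition analytic_diffeo {R : realType} {V W : normedModType R}
    (U : set V) (U' : set W) (f : V -> W) : Prop :=
  [/\ open U, open U', set_bij U U' f, analytic_on U f &
      exists g : W -> V, analytic_on U' g /\ forall u, U u -> g (f u) = u].

Definition vec2 {R : realType} (x y : R) : 'cV[R]_2 :=
  \col_(i < 2) [:: x; y]`_i.

Definition monomials2 {R : realType} (z : 'cV[R]_2) : 'cV[R]_6 :=
  let x := z 0 0 in let y := z 1 0 in
  \col_(j < 6) [:: 1; x; y; x ^+ 2; x * y; y ^+ 2]`_j.

(* An element of Q_2 is given by its 12 coefficients; the two rows are the
   components P and Q, the columns follow the order of monomials2. *)
Definition quad_field {R : realType} (Y : 'M[R]_(2, 6)) (z : 'cV[R]_2) :
  'cV[R]_2 := Y *m monomials2 z.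

(* Coefficients of a quadratic field, recovered from its values (see
   quad_coefK); this has no meaning on fields that are not quadratic. *)
Definition quad_coef {R : realType} (F : 'cV[R]_2 -> 'cV[R]_2) :
    'M[R]_(2, 6) :=
  \matrix_(i < 2, j < 6)
    let f x y := F (vec2 x y) i 0 in
    [:: f 0 0;
        (f 1 0 - f (-1) 0) / 2;
        (f 0 1 - f 0 (-1)) / 2;
        (f 1 0 + f (-1) 0) / 2 - f 0 0;
        f 1 1 - f 1 0 - f 0 1 + f 0 0;
        (f 0 1 + f 0 (-1)) / 2 - f 0 0]`_j.

(* The pair (A, b) encodes the affine map z |-> A z + b. *)
Definition affine (R : realType) : Type := ('M[R]_2 * 'cV[R]_2)%type.

Definition Aff2 {R : realType} : set (affine R) :=
  [set Phi | Phi.1 \in unitmx].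

Definition affine_id {R : realType} : affine R := (1%:M, 0).

Definition affine_map {R : realType} (Phi : affine R) (z : 'cV[R]_2) :
  'cV[R]_2 := Phi.1 *m z + Phi.2.

(* The differential of an affine map is its linear part, see affine_map_diff. *)
Definition pullback {R : realType} (Phi : affine R)
    (F : 'cV[R]_2 -> 'cV[R]_2) (z : 'cV[R]_2) : 'cV[R]_2 :=
  invmx Phi.1 *m F (affine_map Phi z).

(* The family X_lambda, with lambda = (B, mu2, mu3, mu4, mu5). *)
Definition X {R : realType} (lambda : 'rV[R]_5) (z : 'cV[R]_2) : 'cV[R]_2 :=
  let B := lambda 0 0 in let mu2 := lambda 0 1 in let mu3 := lambda 0 2 in
  let mu4 := lambda 0 3 in let mu5 := lambda 0 4 in
  let x := z 0 0 in let y := z 1 0 in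
  vec2 (- y + B * x ^+ 2 + mu2 * y ^+ 2 + (mu4 + B * mu5) * x)
       (x + x * y + mu3 * y ^+ 2 + (1 - 2 * B) * mu5 * y).

Definition represented {R : realType} (p : affine R * R * 'rV[R]_5)
    (z : 'cV[R]_2) : 'cV[R]_2 :=
  p.1.2 *: pullback p.1.1 (X p.2) z.

Definition S_map {R : realType} (p : affine R * R * 'rV[R]_5) : 'M[R]_(2, 6) :=
  quad_coef (represented p).

Definition solution_on {R : realType} (F : 'cV[R]_2 -> 'cV[R]_2) (D : set R)
    (gamma : R -> 'cV[R]_2) : Prop :=
  forall t : R, D t -> is_derive t 1 gamma (F (gamma t)).

Definition periodic_solution {R : realType} (F : 'cV[R]_2 -> 'cV[R]_2)
    (gamma : R -> 'cV[R]_2) : Prop :=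
  [/\ solution_on F setT gamma,
      exists T : R, 0 < T /\ forall t, gamma (t + T) = gamma t &
      exists t, gamma t <> gamma 0].

(* An oriented curve is a class of parametrizations up to increasing
   homeomorphisms of the line. *)
Definition oriented_curve {R : realType} (gamma : R -> 'cV[R]_2) :
    set (R -> 'cV[R]_2) :=
  [set gamma \o h | h in [set h : R -> R |
     {homo h : s t / s < t} /\ forall u, exists s, h s = u]].

Definition oriented_periodic_orbit {R : realType}
    (F : 'cV[R]_2 -> 'cV[R]_2) (C : set (R -> 'cV[R]_2)) : Prop :=
  exists2 gamma, periodic_solution F gamma & C = oriented_curve gamma.

Definition map_curve {R : realType} (Phi : affine R)
    (C : set (R -> 'cV[R]_2)) : set (R -> 'cV[R]_2) :=
  [set affine_map Phi \o gamma | gamma in C].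

(* sigma restricted to ]-d, d[ parametrizes the section. *)
Definition transverse_section {R : realType} (F : 'cV[R]_2 -> 'cV[R]_2)
    (sigma : R -> 'cV[R]_2) (d : R) : Prop :=
  [/\ analytic_on `]-d, d[ sigma, set_inj `]-d, d[ sigma &
      forall s : R, - d < s < d ->
        \det (row_mx (derive1 sigma s) (F (sigma s)) : 'M[R]_2) != 0].

(* The trajectory of F issued from p meets Sigma for the first time in
   positive time at q. *)
Definition first_return {R : realType} (F : 'cV[R]_2 -> 'cV[R]_2)
    (Sigma : set 'cV[R]_2) (p q : 'cV[R]_2) : Prop :=
  exists (tau : R) (phi : R -> 'cV[R]_2),
    [/\ 0 < tau, solution_on F `[0, tau] phi, phi 0 = p, phi tau = q &
        Sigma q /\ forall t : R, 0 < t < tau -> ~ Sigma (phi t)].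

(* None stands for infinite order. *)
Definition vanishing_order {R : realType} (f : R -> R) (a : R)
    (m : option nat) : Prop :=
  if m is Some k then
    (forall j, (j < k)%N -> derive1n j f a = 0) /\ derive1n k f a != 0
  else forall j, derive1n j f a = 0.

(* P is the return map read in the coordinate s of the section, for which the
   orbit sits at s = 0.  The order does not depend on the section. *)
Definition orbit_multiplicity {R : realType} (F : 'cV[R]_2 -> 'cV[R]_2)
    (C : set (R -> 'cV[R]_2)) (m : option nat) : Prop :=
  exists (sigma : R -> 'cV[R]_2) (d : R) (P : R -> R),
    [/\ 0 < d /\ transverse_section F sigma d,
        exists2 gamma, C gamma & range gamma (sigma 0),
        analytic_at P 0 /\ P 0 = 0,
        \forall s \near (0 : R),
          first_return F (sigma @` `]-d, d[) (sigma s) (sigma (P s)) &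
        vanishing_order (fun s => P s - s) 0 m].

Lemma col2E {R : realType} (u v : 'cV[R]_2) :
  u 0 0 = v 0 0 -> u 1 0 = v 1 0 -> u = v.
Proof.
move=> h0 h1; apply/matrixP => i j; rewrite (ord1 j).
case: i => [[|[|//]]] hi.
- by rewrite (_ : Ordinal hi = 0) //; apply/val_inj.
- by rewrite (_ : Ordinal hi = 1) //; apply/val_inj.
Qed.

Lemma vec2K {R : realType} (z : 'cV[R]_2) : vec2 (z 0 0) (z 1 0) = z.
Proof. by apply: col2E; rewrite !mxE. Qed.

Lemma quad_fieldE {R : realType} (Y : 'M[R]_(2, 6)) (x y : R) i :
  quad_field Y (vec2 x y) i 0 =
    Y i 0 + Y i 1 * x + Y i 2 * y + Y i 3 * x ^+ 2 + Y i 4 * (x * y)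
    + Y i 5 * y ^+ 2.
Proof.
rewrite !mxE !big_ord_recl big_ord0 !mxE /= !mulr1 addr0 !addrA.
by repeat (congr (_ + _)); congr (Y i _ * _); apply/val_inj.
Qed.

Lemma quad_coefK {R : realType} : cancel (@quad_field R) quad_coef.
Proof.
move=> Y; apply/matrixP => i j; rewrite mxE /= !quad_fieldE.
have jE k (hk : (k < 6)%N) (l : 'I_6) : k = l :> nat -> Ordinal hk = l.
  by move=> ?; apply/val_inj.
case: j => [[|[|[|[|[|[|//]]]]]]] hj /=.
- by rewrite (jE _ hj 0) //; field.
- by rewrite (jE _ hj 1) //; field.
- by rewrite (jE _ hj 2) //; field.
- by rewrite (jE _ hj 3) //; field.
- by rewrite (jE _ hj 4) //; field.
- by rewrite (jE _ hj 5) //; field.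
Qed.

Lemma affine_map_diff {R : realType} (Phi : affine R) (z v : 'cV[R]_2) :
  is_derive z v (affine_map Phi) (Phi.1 *m v).
Proof.
have quotE : (fun h : R =>
    h^-1 *: (affine_map Phi (h *: v + z) - affine_map Phi z)) @ 0^' -->
    Phi.1 *m v.
  apply: (cvg_trans _ (@cvg_cst _ (Phi.1 *m v) _ (0^' : set_system R) _)).
  apply: near_eq_cvg; near=> h; rewrite /cst.
  have h0 : h != 0 by near: h; exact: nbhs_dnbhs_neq.
  rewrite /affine_map mulmxDr -scalemxAr opprD addrACA subrr addr0 addrK.
  by rewrite scalerA mulVf // scale1r.
split; first exact: cvgP quotE.
exact: cvg_lim quotE.
Unshelve. all: by end_near. Qed.

Lemma quad_field_S_map {R : realType} (p : affine R * R * 'rV[R]_5) :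
  quad_field (S_map p) = represented p.
Proof.
apply/funext => z; rewrite -(vec2K z).
move: (z 0 0) (z 1 0) => x y; case: p => [[[A b] rho] l].
apply/matrixP => i j; rewrite (ord1 j) quad_fieldE !mxE /=.
rewrite /represented /pullback /=; move: (invmx A) => A'.
rewrite /affine_map /X /= !(mxE, big_ord_recl, big_ord0) /=.
have -> : lift ord0 ord0 = 1 :> 'I_2 by apply/val_inj.
by rewrite /=; field.
Qed.

Lemma quad_field_X {R : realType} (lambda : 'rV[R]_5) :
  quad_field (quad_coef (X lambda)) = X lambda.
Proof.
have E : represented (affine_id, 1, lambda) = X lambda.
  apply/funext => z; rewrite /represented /pullback /affine_map /=.
  by rewrite invmx1 !mul1mx addr0 scale1r.
by rewrite -E -[LHS]/(quad_field (S_map _)) quad_field_S_map.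
Qed.

(* Main.v *)
Require Import Defs.
From mathcomp Require Import all_boot all_order all_algebra.
From mathcomp Require Import ring lra.
From mathcomp Require Import all_classical all_reals all_analysis.

(* The equation [Y = rho Phi^* X_lambda], multiplied by the linear part of Phi,
   is a polynomial system of twelve equations in twelve unknowns, and its
   differential at [(id, 1, 0)] is solved explicitly.  The Picard iterates of the
   corresponding Newton map are polynomials in Y; they form a Cauchy sequence not
   only pointwise but for the majorant norm sum |a_alpha| r^|alpha|, so the limit
   is a convergent power series, and the recentring at a neighbouring point comes
   for free.  The same argument, with the roles of Y and (Phi, rho, lambda)
   exchanged, gives the analyticity of S without inverting matrices.
   Periodic orbits, sections and return maps are transported by
   [gamma |-> Phi (gamma (t / rho))], which leaves the return map unchanged in
   the coordinate of the section. *)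

Set Implicit Arguments.
Unset Strict Implicit.
Unset Printing Implicit Defensive.

Import Order.TTheory GRing.Theory Num.Theory.
Import numFieldNormedType.Exports.

Local Open Scope classical_set_scope.
Local Open Scope ring_scope.

(** * Majorants and power series *)

(** [majorized] includes the assertion that the function is a polynomial, so one bound controls all
    its coefficients, and [sdiff] says in particular that differences of values along polynomial
    families are again polynomial. Only polynomials are ever composed; substitution into an infinite
    series does not occur. The estimates are quantified over the number of variables, and zero is
    allowed: a family in zero variables is a point, so one hypothesis yields both the numerical
    contraction behind existence, uniqueness and Lipschitz dependence, and the coefficient bounds
    behind analyticity. Preconditioning by the inverse differential makes the derivative in the
    unknowns vanish, which gives a contraction factor 1/2 on a small enough box. *)

Definition deg {n : nat} (alpha : {ffun 'I_n -> nat}) : nat :=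
  (\sum_(i < n) alpha i)%N.

Definition peval {R : realType} {n : nat}
    (s : seq (R * {ffun 'I_n -> nat})) (t : 'rV[R]_n) : R :=
  \sum_(p <- s) p.1 * multi_power t p.2.

Definition pnorm {R : realType} {n : nat} (r : R)
    (s : seq (R * {ffun 'I_n -> nat})) : R :=
  \sum_(p <- s) `|p.1| * r ^+ deg p.2.

(* A bound for the quotient of [pnorm] by equality of polynomial functions, so
   that pointwise identities may be used before estimating. *)
Definition majorized {R : realType} {n : nat} (r M : R) (f : 'rV[R]_n -> R) :=
  exists2 s, f =1 peval s & pnorm r s <= M.

Lemma degD {n : nat} (alpha beta : {ffun 'I_n -> nat}) :
  deg [ffun i => alpha i + beta i]%N = (deg alpha + deg beta)%N.
Proof.
by rewrite /deg -big_split; apply: eq_bigr => i _; rewrite ffunE.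
Qed.

Section Majorized.
Context {R : realType} {n : nat}.
Implicit Types (r M N c : R) (f g : 'rV[R]_n -> R) (t : 'rV[R]_n).

Lemma multi_powerD t (alpha beta : {ffun 'I_n -> nat}) :
  multi_power t [ffun i => alpha i + beta i]%N =
  multi_power t alpha * multi_power t beta.
Proof.
by rewrite /multi_power -big_split; apply: eq_bigr => i _; rewrite ffunE exprD.
Qed.

Lemma multi_power0 t : multi_power t [ffun=> 0%N] = 1.
Proof. by rewrite /multi_power big1 // => i _; rewrite ffunE expr0. Qed.

Lemma multi_powerX t i : multi_power t [ffun j => (j == i) : nat] = t 0 i.
Proof.
rewrite /multi_power (bigD1 i) //= big1 ?ffunE ?eqxx ?expr1 ?mulr1 //.
by move=> j /negbTE ji; rewrite ffunE ji expr0.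
Qed.

Lemma normr_multi_power r t (alpha : {ffun 'I_n -> nat}) :
  (forall i, `|t 0 i| <= r) -> `|multi_power t alpha| <= r ^+ deg alpha.
Proof.
move=> tr; rewrite /multi_power /deg normr_prod expr_sum.
by apply: ler_prod => i _; rewrite normr_ge0 normrX lerXn2r ?nnegrE //;
  exact: le_trans (tr i).
Qed.

Lemma pnorm_ge0 r s : 0 <= r -> 0 <= @pnorm R n r s.
Proof. by move=> r0; apply: sumr_ge0 => p _; rewrite mulr_ge0 ?exprn_ge0. Qed.

Lemma majorized_bound r M f t :
  (forall i, `|t 0 i| <= r) -> majorized r M f -> `|f t| <= M.
Proof.
move=> tr [s fs]; apply: le_trans; rewrite fs.
apply: le_trans (ler_norm_sum _ _ _) _; apply: ler_sum => p _.
by rewrite normrM ler_wpM2l // normr_multi_power.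
Qed.

Lemma majorized_le r M N f : M <= N -> majorized r M f -> majorized r N f.
Proof. by move=> MN [s fs sM]; exists s => //; exact: le_trans MN. Qed.

Lemma eq_majorized r M f g : f =1 g -> majorized r M f -> majorized r M g.
Proof. by move=> fg [s fs sM]; exists s => // t; rewrite -fg. Qed.

Lemma majorized0 r M : 0 <= M -> majorized r M (fun _ : 'rV[R]_n => 0).
Proof.
by move=> M0; exists [::] => [t|]; rewrite /peval /pnorm big_nil.
Qed.

Lemma majorized_cst r c : majorized r `|c| (fun _ : 'rV[R]_n => c).
Proof.
exists [:: (c, [ffun=> 0%N])] => [t|]; rewrite /peval /pnorm big_seq1.
  by rewrite multi_power0 mulr1.
by rewrite /deg big1 ?expr0 ?mulr1 // => i _; rewrite ffunE.
Qed.

Lemma majorized_var r i : majorized r r (fun t => t 0 i).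
Proof.
exists [:: (1, [ffun j => (j == i) : nat])] => [t|]; rewrite /peval /pnorm big_seq1.
  by rewrite multi_powerX mul1r.
rewrite normr1 mul1r /deg (bigD1 i) //= big1 ?ffunE ?eqxx ?expr1 //.
by move=> j /negbTE ji; rewrite ffunE ji.
Qed.

Lemma majorizedD r M N f g : majorized r M f -> majorized r N g ->
  majorized r (M + N) (fun t => f t + g t).
Proof.
move=> [s fs sM] [s' gs sN]; exists (s ++ s') => [t|].
  by rewrite fs gs /peval big_cat.
by rewrite /pnorm big_cat lerD.
Qed.

(** The weighted l1 norm is chosen for this: the list of all products of terms has norm exactly the
    product of the norms, because exponents add and degrees add with them. *)
Lemma majorizedM r M N f g : 0 <= r -> majorized r M f -> majorized r N g ->
  majorized r (M * N) (fun t => f t * g t).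
Proof.
move=> r0 [s fs sM] [s' gs sN].
pose m (p q : R * {ffun 'I_n -> nat}) :=
  (p.1 * q.1, [ffun i => p.2 i + q.2 i]%N).
exists [seq m p q | p <- s, q <- s'] => [t|].
  rewrite fs gs /peval big_allpairs_dep mulr_suml; apply: eq_bigr => p _.
  by rewrite mulr_sumr; apply: eq_bigr => q _; rewrite multi_powerD mulrACA.
apply: (le_trans _ (ler_pM (pnorm_ge0 s r0) (pnorm_ge0 s' r0) sM sN)).
rewrite le_eqVlt; apply/orP; left; apply/eqP.
rewrite /pnorm big_allpairs_dep mulr_suml; apply: eq_bigr => p _.
rewrite mulr_sumr; apply: eq_bigr => q _ /=; rewrite normrM.
by rewrite degD exprD mulrACA.
Qed.

Lemma majorizedN r M f : majorized r M f -> majorized r M (fun t => - f t).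
Proof.
move=> [s fs sM]; exists [seq (- p.1, p.2) | p <- s] => [t|].
  by rewrite fs /peval big_map -sumrN; apply: eq_bigr => p _; rewrite mulNr.
by rewrite /pnorm big_map (eq_bigr (fun p => `|p.1| * r ^+ deg p.2)) // => p _;
  rewrite normrN.
Qed.

End Majorized.

(** * Sums over boxes of exponents, and geometric series *)

Section BoxSum.
Context {R : realType} {n : nat} {W : normedModType R}.

Definition box N : seq {ffun 'I_n -> nat} :=
  [seq [ffun i => k i : nat] | k : {ffun 'I_n -> 'I_N}].

Lemma box_uniq N : uniq (box N).
Proof.
rewrite map_inj_uniq ?enum_uniq // => k l /ffunP kl; apply/ffunP => i.
by apply/val_inj; have := kl i; rewrite !ffunE.
Qed.

Lemma mem_box N (alpha : {ffun 'I_n -> nat}) :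
  (alpha \in box N) = [forall i, alpha i < N]%N.
Proof.
apply/mapP/forallP => [[k _ ->] i|aN]; first by rewrite ffunE.
exists [ffun i => Ordinal (aN i)]; first by rewrite mem_enum.
by apply/ffunP => i; rewrite !ffunE.
Qed.

Lemma box_sumE (a : {ffun 'I_n -> nat} -> W) N :
  box_sum a N = \sum_(alpha <- box N) a alpha.
Proof. by rewrite /box_sum /box big_map big_enum. Qed.

Lemma box_sub m N : (m <= N)%N -> {subset box m <= box N}.
Proof.
move=> mN alpha; rewrite !mem_box => /forallP am; apply/forallP => i.
exact: leq_trans (am i) mN.
Qed.

(** This provides a box that contains every exponent of finitely many polynomials, beyond which they
    have no remainder. *)
Lemma box_cofinal (s : seq {ffun 'I_n -> nat}) :
  exists N, {subset s <= box N}.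
Proof.
elim: s => [|alpha s [N sN]]; first by exists 0%N.
exists (maxn (\max_i alpha i).+1 N) => beta; rewrite inE => /orP[/eqP ->|/sN].
  rewrite mem_box; apply/forallP => i; rewrite leq_max ltnS.
  by rewrite (leq_bigmax i).
by apply: box_sub; rewrite leq_maxr.
Qed.

End BoxSum.

Lemma ler_sum_sub {R : realType} {I : eqType} (s s' : seq I) (f : I -> R) :
  uniq s -> {subset s <= s'} -> (forall i, 0 <= f i) ->
  \sum_(i <- s) f i <= \sum_(i <- s') f i.
Proof.
elim: s s' => [|a s IH] s' /=; first by rewrite big_nil => _ _ f0; exact: sumr_ge0.
move=> /andP[as' us] ss f0; have as0 : a \in s' by rewrite ss ?inE ?eqxx.
rewrite big_cons (perm_big _ (perm_to_rem as0)) big_cons lerD2l; apply: IH => // b bs.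
have : b \in s' by rewrite ss // inE bs orbT.
rewrite (perm_mem (perm_to_rem as0)) inE => /orP[/eqP ba|//].
by rewrite -ba bs in as'.
Qed.

Lemma box_sum_nondecreasing {R : realType} {n : nat}
    (a : {ffun 'I_n -> nat} -> R) :
  (forall alpha, 0 <= a alpha) -> nondecreasing_seq (box_sum a).
Proof.
move=> a0 m N mN; rewrite !box_sumE; apply: ler_sum_sub => //.
  exact: box_uniq.
exact: box_sub.
Qed.

Lemma box_sum_cvg {R : realType} {n : nat}
    (a : {ffun 'I_n -> nat} -> R) M :
  (forall alpha, 0 <= a alpha) -> (forall N, box_sum a N <= M) ->
  cvgn (box_sum a).
Proof.
move=> a0 aM; apply: nondecreasing_is_cvgn; first exact: box_sum_nondecreasing.
by exists M => _ [N _ <-].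
Qed.

Lemma norm_lim_le {R : realType} (u : nat -> R) l C :
  u @ \oo --> l -> (\forall N \near \oo, `|u N| <= C) -> `|l| <= C.
Proof. by move=> ul uC; exact: ler_cvg_to (cvg_norm ul) (cvg_cst C) uC. Qed.

Lemma cvg_sum_seq {R : realType} {W : normedModType R} {I : Type} (s : seq I)
    (f : I -> nat -> W) (l : I -> W) :
  (forall i, f i @ \oo --> l i) ->
  (fun N => \sum_(i <- s) f i N) @ \oo --> \sum_(i <- s) l i.
Proof. by move=> fl; apply: cvg_big => //; exact: add_continuous. Qed.

Lemma sum_geometric_le {R : realType} (u : nat -> R) M K N : 0 <= M ->
  (forall k, `|u k| <= M / 2 ^+ k) ->
  \sum_(K <= k < N) `|u k| <= 2 * M / 2 ^+ K.
Proof.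
move=> M0 uM; have pos k : 0 <= 2 * M / 2 ^+ k.
  by rewrite divr_ge0 ?mulr_ge0 ?exprn_ge0.
have [KN|NK] := leqP K N; last by rewrite big_geq // ltnW.
(* Subtracting the exact tail strengthens the claim enough for the induction on [N] to close with
   equality. *)
suff : \sum_(K <= k < N) `|u k| <= 2 * M / 2 ^+ K - 2 * M / 2 ^+ N.
  by move=> /le_trans; apply; rewrite gerBl.
elim: N KN => [|N IH].
  by rewrite leqn0 => /eqP ->; rewrite big_geq // subrr.
rewrite leq_eqVlt => /orP[/eqP ->|KN]; first by rewrite big_geq // subrr.
rewrite big_nat_recr //=; apply: le_trans (lerD (IH KN) (uM N)) _.
rewrite -addrA lerD2l exprS le_eqVlt; apply/orP; left; apply/eqP.
by field; exact: expf_neq0.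
Qed.

Lemma geometric_cvg {R : realType} (u : nat -> R) M :
  (forall k, `|u k| <= M / 2 ^+ k) -> cvgn (series u).
Proof.
move=> uM; have M0 : 0 <= M by have := uM 0%N; rewrite expr0 divr1; exact: le_trans.
apply: normed_cvg; apply: nondecreasing_is_cvgn.
  by apply: nondecreasing_series => k _ _ /=.
by exists (2 * M / 2 ^+ 0) => _ [N _ <-]; exact: sum_geometric_le.
Qed.

Lemma geometric_tail_le {R : realType} (u : nat -> R) M l K :
  (forall k, `|u k| <= M / 2 ^+ k) -> series u @ \oo --> l ->
  `|l - series u K| <= 2 * M / 2 ^+ K.
Proof.
move=> uM ul; have M0 : 0 <= M by have := uM 0%N; rewrite expr0 divr1; exact: le_trans.
apply: (@norm_lim_le _ (fun N => series u N - series u K)).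
  by apply: cvgB => //; exact: cvg_cst.
near=> N; have KN : (K <= N)%N by near: N; exact: nbhs_infty_ge.
rewrite sub_series KN; apply: le_trans (sum_geometric_le K N M0 uM).
exact: ler_norm_sum.
Unshelve. all: by end_near. Qed.

(** * From geometrically majorized polynomials to a power series *)

Section PowerSeries.
Context {R : realType} {n : nat}.
Notation monomial := (R * {ffun 'I_n -> nat})%type.
Implicit Types (s : seq monomial) (t : 'rV[R]_n).

(** A list may repeat an exponent, hence a sum over its occurrences. *)
Definition pcoef s (alpha : {ffun 'I_n -> nat}) : R :=
  \sum_(p <- s | p.2 == alpha) p.1.

Lemma sum_by_exponent s (b : seq {ffun 'I_n -> nat}) (G : monomial -> R) :
  uniq b ->
  \sum_(alpha <- b) \sum_(p <- s | p.2 == alpha) G p =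
  \sum_(p <- s | p.2 \in b) G p.
Proof.
move=> ub; rewrite (exchange_big_dep predT) //= [RHS]big_mkcond /=.
apply: eq_bigr => p _; rewrite -big_filter.
have [pb|pb] := boolP (p.2 \in b).
  rewrite (_ : [seq _ <- b | _] = [:: p.2]) ?big_seq1 //.
  rewrite (@eq_filter _ _ (pred1 p.2)) ?filter_pred1_uniq //.
rewrite (_ : [seq _ <- b | _] = [::]) ?big_nil //.
apply/eqP; rewrite -[_ == _]negbK -has_filter; apply/hasPn => alpha ab.
by apply: contra pb => pa; rewrite (_ : p.2 = alpha) //; apply/eqP.
Qed.

Lemma sum_pcoef s b t : uniq b ->
  \sum_(alpha <- b) multi_power t alpha * pcoef s alpha =
  \sum_(p <- s | p.2 \in b) p.1 * multi_power t p.2.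
Proof.
move=> ub; rewrite -(sum_by_exponent _ _ ub); apply: eq_bigr => alpha _.
by rewrite mulr_sumr; apply: eq_bigr => p /eqP <-; rewrite mulrC.
Qed.

Lemma sum_norm_pcoef_le s b r : 0 <= r -> uniq b ->
  \sum_(alpha <- b) `|pcoef s alpha| * r ^+ deg alpha <= pnorm r s.
Proof.
move=> r0 ub.
apply: (@le_trans _ _ (\sum_(p <- s | p.2 \in b) `|p.1| * r ^+ deg p.2)).
  rewrite -(sum_by_exponent _ _ ub); apply: ler_sum => alpha _.
  apply: le_trans (ler_wpM2r _ (ler_norm_sum _ _ _)) _; first exact: exprn_ge0.
  by rewrite mulr_suml; apply: ler_sum => p /eqP <-.
rewrite /pnorm big_mkcond /=; apply: ler_sum => p _; case: ifP => // _.
by rewrite mulr_ge0 ?exprn_ge0.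
Qed.

Lemma norm_pcoef_le s r alpha : 0 <= r ->
  `|pcoef s alpha| * r ^+ deg alpha <= pnorm r s.
Proof.
move=> r0; have := @sum_norm_pcoef_le s [:: alpha] r r0 isT.
by rewrite big_seq1.
Qed.

(** The monomials with exponent in [b] cancel, and those that remain are bounded by their share of
    the norm. *)
Lemma peval_sub_le s b r t : 0 <= r -> (forall i, `|t 0 i| <= r) -> uniq b ->
  `|peval s t - \sum_(alpha <- b) multi_power t alpha * pcoef s alpha| <=
  pnorm r s.
Proof.
move=> r0 tr ub; rewrite sum_pcoef // /peval [X in _ - X]big_mkcond /= -sumrB.
apply: le_trans (ler_norm_sum _ _ _) _; apply: ler_sum => p _.
have H : 0 <= `|p.1| * r ^+ deg p.2 by rewrite mulr_ge0 ?exprn_ge0.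
case: ifP => _; first by rewrite subrr normr0.
by rewrite subr0 normrM ler_wpM2l // normr_multi_power.
Qed.

Lemma peval_pcoef s b t : uniq b -> {subset [seq p.2 | p <- s] <= b} ->
  peval s t = \sum_(alpha <- b) multi_power t alpha * pcoef s alpha.
Proof.
move=> ub sb; rewrite sum_pcoef // /peval [RHS]big_mkcond /= !big_seq.
by apply: eq_bigr => p ps; rewrite sb //; exact: map_f.
Qed.

(** The double sum over [k] and over exponents converges absolutely on the whole polydisc, so it may
    be resummed by exponents. The coefficients are fixed before [t], hence one series serves every
    point. *)
Lemma power_series_of_majorized (r M : R) (f : nat -> 'rV[R]_n -> R) : 0 < r ->
  (forall k, majorized r (M / 2 ^+ k) (f k)) ->
  exists c : {ffun 'I_n -> nat} -> R, forall t (l : R),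
    (forall i, `|t 0 i| <= r) -> series (f ^~ t) @ \oo --> l ->
    (forall N, box_sum (fun alpha => `|multi_power t alpha * c alpha|) N <= 2 * M)
    /\ box_sum (fun alpha => multi_power t alpha * c alpha) @ \oo --> l.
Proof.
move=> r0 fM; have r0' := ltW r0.
have [s sP] := choice (fun k => let: ex_intro2 s h1 h2 := fM k in
  ex_intro (fun s => f k =1 peval s /\ pnorm r s <= M / 2 ^+ k) s (conj h1 h2)).
have fs k : f k =1 peval (s k) by case: (sP k).
have sM k : pnorm r (s k) <= M / 2 ^+ k by case: (sP k).
have M0 : 0 <= M.
  by have := sM 0%N; rewrite expr0 divr1; apply: le_trans; exact: pnorm_ge0.
have cM alpha k : `|pcoef (s k) alpha| <= M / r ^+ deg alpha / 2 ^+ k.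
  rewrite mulrAC ler_pdivlMr ?exprn_gt0 //.
  by apply: le_trans (norm_pcoef_le _ _ r0') _.
pose c alpha := limn (series (fun k => pcoef (s k) alpha)).
have cE alpha : series (fun k => pcoef (s k) alpha) @ \oo --> c alpha.
  exact: geometric_cvg (cM alpha).
have cvgc (g : _ -> R) b : (fun N => \sum_(alpha <- b)
    g alpha * series (fun k => pcoef (s k) alpha) N) @ \oo -->
    \sum_(alpha <- b) g alpha * c alpha.
  by apply: cvg_sum_seq => alpha; apply: cvgMr.
exists c => t l tr fl.
(* Over finitely many exponents, the two sums in the partial sums are exchanged, each polynomial is
   bounded by its norm, and the bound passes to the limit. *)
have bound b : uniq b -> \sum_(alpha <- b) `|c alpha| * r ^+ deg alpha <= 2 * M.
  move=> ub; rewrite -[leLHS]ger0_norm; last first.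
    by apply: sumr_ge0 => alpha _; rewrite mulr_ge0 ?exprn_ge0.
  apply: (@norm_lim_le _ (fun N => \sum_(alpha <- b)
      `|series (fun k => pcoef (s k) alpha) N| * r ^+ deg alpha)).
    by apply: cvg_sum_seq => alpha; apply: cvgMl; exact: cvg_norm.
  apply: nearW => N; rewrite ger0_norm; last first.
    by apply: sumr_ge0 => alpha _; rewrite mulr_ge0 ?exprn_ge0.
  apply: (@le_trans _ _ (\sum_(0 <= k < N) `|pnorm r (s k)|)); last first.
    rewrite -[leRHS]divr1 -(expr0 2); apply: sum_geometric_le => // k.
    by rewrite ger0_norm ?pnorm_ge0.
  apply: (@le_trans _ _ (\sum_(alpha <- b) \sum_(0 <= k < N)
      `|pcoef (s k) alpha| * r ^+ deg alpha)).
    apply: ler_sum => alpha _; rewrite -mulr_suml ler_wpM2r ?exprn_ge0 //.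
    exact: ler_norm_sum.
  rewrite exchange_big /=; apply: ler_sum => k _.
  by rewrite ger0_norm ?pnorm_ge0 // sum_norm_pcoef_le.
split=> [N|].
  rewrite box_sumE; apply: le_trans (bound _ (box_uniq N)).
  apply: ler_sum => alpha _; rewrite normrM mulrC ler_wpM2l //.
  exact: normr_multi_power.
apply/cvgrPdist_le => e e0.
have [K KP] : exists K, 2 * M / 2 ^+ K <= e.
  have : geometric (2 * M) (2^-1 : R) @ \oo --> (0 : R).
    by apply: cvg_geometric; rewrite ger0_norm // invf_lt1 // ltr1n.
  move=> /cvgr0Pnorm_le /(_ e e0) [K _ /(_ K (leqnn K))] /= H.
  by exists K; rewrite -exprVn; apply: le_trans H; exact: ler_norm.
(* Past [N0] the first [K] polynomials lie entirely in the box and leave no remainder; the others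
   contribute at most the geometric tail chosen in [KP]. *)
have [N0 HN0] := box_cofinal
  (flatten [seq [seq p.2 | p <- s k] | k <- iota 0 K]).
exists N0 => // N /= N0N; rewrite box_sumE.
apply: le_trans KP; apply: (@norm_lim_le _ (fun J => series (f ^~ t) J -
   \sum_(alpha <- box N) multi_power t alpha * series (fun k => pcoef (s k) alpha) J)).
  by apply: cvgB.
near=> J; have KJ : (K <= J)%N by near: J; exact: nbhs_infty_ge.
pose h k := f k t - \sum_(alpha <- box N) multi_power t alpha * pcoef (s k) alpha.
rewrite (_ : _ - _ = \sum_(0 <= k < J) h k); last first.
  rewrite sumrB; congr (_ - _); rewrite exchange_big /=.
  by apply: eq_bigr => alpha _; rewrite mulr_sumr.
rewrite (big_cat_nat _ (n := K)) //= big_nat big1 ?add0r => [|k /andP[_ kK]].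
  apply: le_trans (ler_norm_sum _ _ _) _; apply: sum_geometric_le => // k.
  apply: le_trans (sM k); rewrite /h fs; apply: peval_sub_le => //.
  exact: box_uniq.
rewrite /h fs -peval_pcoef ?subrr //; first exact: box_uniq.
move=> alpha ak; apply: (box_sub N0N); apply: HN0.
by apply/flatten_mapP; exists k; rewrite // mem_iota.
Unshelve. all: by end_near. Qed.

End PowerSeries.

(** * The analytic implicit function theorem *)

(* Strict differentiability at u0 with differential l, the estimates being
   required for polynomial families of points and in the majorant norm. *)
Definition sdiff {R : realType} {I : Type} (u0 : I -> R) (h l : (I -> R) -> R) :=
  exists2 K : R, 0 <= K &
  forall n (r e D : R) (u v : 'rV[R]_n -> I -> R),
    0 <= r -> 0 <= e <= 1 -> 0 <= D ->
    (forall i, majorized r e (fun t => u t i - u0 i)) ->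
    (forall i, majorized r e (fun t => v t i - u0 i)) ->
    (forall i, majorized r D (fun t => u t i - v t i)) ->
    majorized r (K * D) (fun t => h (u t) - h (v t)) /\
    majorized r (K * e * D)
      (fun t => h (u t) - h (v t) - l (fun i => u t i - v t i)).

(** * Rules of strict differentiation *)

Section StrictDiff.
Context {R : realType} {I : Type} (u0 : I -> R).
Implicit Types (h g l m : (I -> R) -> R).

Lemma sdiff_cst c : sdiff u0 (fun=> c) (fun=> 0).
Proof.
exists 0 => // n r e D u v r0 e01 D0 _ _ _; rewrite !mul0r subrr subr0.
by split; exact: majorized0.
Qed.

Lemma sdiff_var i : sdiff u0 (fun u => u i) (fun du => du i).
Proof.
exists 1 => // n r e D u v r0 /andP[e0 _] D0 _ _ uv; rewrite !mul1r; split=> //.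
by apply: eq_majorized (majorized0 _ _) => [t|]; rewrite ?subrr ?mulr_ge0.
Qed.

Lemma sdiffN h l : sdiff u0 h l -> sdiff u0 (fun u => - h u) (fun du => - l du).
Proof.
move=> [K K0 hK]; exists K => // n r e D u v r0 e01 D0 ue ve uv.
have [h1 h2] := hK n r e D u v r0 e01 D0 ue ve uv; split.
  by apply: eq_majorized (majorizedN h1) => t; rewrite opprD.
by apply: eq_majorized (majorizedN h2) => t; rewrite !opprD.
Qed.

Lemma sdiffD h g l m : sdiff u0 h l -> sdiff u0 g m ->
  sdiff u0 (fun u => h u + g u) (fun du => l du + m du).
Proof.
move=> [K K0 hK] [L L0 gL]; exists (K + L); first exact: addr_ge0.
move=> n r e D u v r0 e01 D0 ue ve uv.
have [h1 h2] := hK n r e D u v r0 e01 D0 ue ve uv.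
have [g1 g2] := gL n r e D u v r0 e01 D0 ue ve uv; rewrite !mulrDl; split.
  by apply: eq_majorized (majorizedD h1 g1) => t; ring.
by apply: eq_majorized (majorizedD h2 g2) => t; ring.
Qed.

(** The difference of products is [h u * (g u - g v) + (h u - h v) * g v]; then [h u] and [g v] are
    expanded around the base point, by applying the hypotheses with the constant family [u0] as
    second argument. The condition [e <= 1] lets the first bound absorb [K * e] into [K]; in the
    second bound the constants match exactly. *)
Lemma sdiffM h g l m : sdiff u0 h l -> sdiff u0 g m ->
  sdiff u0 (fun u => h u * g u) (fun du => h u0 * m du + g u0 * l du).
Proof.
move=> [K K0 hK] [L L0 gL].
exists ((`|h u0| + K) * L + K * (`|g u0| + L)).
  by rewrite addr_ge0 ?mulr_ge0 ?addr_ge0.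
move=> n r e D u v r0 e01 D0 ue ve uv; case/andP: (e01) => e0 e1.
have [h1 h2] := hK n r e D u v r0 e01 D0 ue ve uv.
have [g1 g2] := gL n r e D u v r0 e01 D0 ue ve uv.
have c0 i : majorized r e (fun _ : 'rV[R]_n => u0 i - u0 i).
  by rewrite subrr; exact: majorized0.
have [h3 _] := hK n r e e u (fun=> u0) r0 e01 e0 ue c0 ue.
have [g3 _] := gL n r e e v (fun=> u0) r0 e01 e0 ve c0 ve.
have ch := @majorized_cst _ n r (h u0); have cg := @majorized_cst _ n r (g u0).
split.
  have := majorizedD (majorizedM r0 (majorizedD ch h3) g1)
                     (majorizedM r0 h1 (majorizedD cg g3)).
  move=> /majorized_le le; apply: eq_majorized (le _ _) => [t|]; first by ring.
  rewrite [leRHS]mulrDl lerD //.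
    by rewrite mulrA !ler_wpM2r // lerD2l ler_piMr.
  by rewrite mulrAC ler_wpM2r // ler_wpM2l // lerD2l ler_piMr.
have := majorizedD
  (majorizedD (majorizedM r0 h3 g1) (majorizedM r0 ch g2))
  (majorizedD (majorizedM r0 h1 g3) (majorizedM r0 cg h2)).
move=> /majorized_le le; apply: eq_majorized (le _ _) => [t|]; first by ring.
by rewrite le_eqVlt; apply/orP; left; apply/eqP; ring.
Qed.

End StrictDiff.

(** Parameters stand on the left and unknowns on the right, under the single index type that [sdiff]
    expects. *)
Definition join {R : Type} {n m : nat} (y : 'I_n -> R) (x : 'I_m -> R)
    (s : 'I_n + 'I_m) : R :=
  match s with inl i => y i | inr j => x j end.

Lemma le_geometric0 {R : realType} (a C : R) :
  (forall k, a <= C / 2 ^+ k) -> a <= 0.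
Proof.
move=> aC; have : geometric C (2^-1 : R) @ \oo --> (0 : R).
  by apply: cvg_geometric; rewrite ger0_norm // invf_lt1 // ltr1n.
move=> /(ler_cvg_to (cvg_cst a)); apply; apply: nearW => k /=.
by rewrite exprVn.
Qed.

Section ImplicitFunction.
Context {R : realType} {n m : nat}.
Variables (T l : 'I_m -> ('I_n + 'I_m -> R) -> R) (y0 : 'I_n -> R) (x0 : 'I_m -> R).
Hypothesis Tdiff : forall j, sdiff (join y0 x0) (T j) (l j).
Hypothesis l0 : forall j du, (forall i, du (inl i) = 0) -> l j du = 0.

(** When the two families have the same parameters, [l0] kills the linear part and only the strict
    differentiability error remains; the radius [(2 * L)^-1] makes that error at most [D / 2]. *)
Lemma uniform_contraction : exists K e : R,
  [/\ 1 <= K, 0 < e &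
  forall k (r D : R) (u v : 'rV[R]_k -> 'I_n + 'I_m -> R), 0 <= r -> 0 <= D ->
    (forall i, majorized r e (fun t => u t i - join y0 x0 i)) ->
    (forall i, majorized r e (fun t => v t i - join y0 x0 i)) ->
    (forall i, majorized r D (fun t => u t i - v t i)) -> forall j,
    majorized r (K * D) (fun t => T j (u t) - T j (v t)) /\
    ((forall t i, u t (inl i) = v t (inl i)) ->
     majorized r (D / 2) (fun t => T j (u t) - T j (v t)))].
Proof.
have [K KP] := choice (fun j => let: ex_intro2 K h1 h2 := Tdiff j in
  ex_intro (fun K => 0 <= K /\ _) K (conj h1 h2)).
(* One constant for all components, at least 1 so that the radius is at most 1 as [sdiff]
   demands. *)
pose L := 1 + \sum_j K j.
have KL j : K j <= L.
  rewrite /L (bigD1 j) //= addrCA lerDl addr_ge0 //.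
  by apply: sumr_ge0 => i _; case: (KP i).
have L1 : 1 <= L by rewrite lerDl; apply: sumr_ge0 => i _; case: (KP i).
have L0 : 0 < L by exact: lt_le_trans L1.
have e01 : 0 < (2 * L)^-1 <= 1.
  by rewrite invr_gt0 mulr_gt0 // invf_le1 ?mulr_gt0 //; nra.
exists L, (2 * L)^-1; split=> //; first by case/andP: e01.
move=> k r D u v r0 D0 ue ve uv j; case: (KP j) => Kj0 /(_ k r (2 * L)^-1 D u v r0).
case/andP: (e01) => e0 e1; rewrite (ltW e0) e1 => /(_ isT D0 ue ve uv) [h1 h2].
split; first by apply: majorized_le h1; rewrite ler_wpM2r.
move=> uvy; apply: eq_majorized (majorized_le _ h2) => [t|].
  by rewrite l0 ?subr0 // => i; rewrite uvy subrr.
rewrite mulrC ler_wpM2l // ler_pdivrMr ?mulr_gt0 // mulKf ?pnatr_eq0 //.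
Qed.

Definition picard (y : 'I_n -> R) (k : nat) : 'I_m -> R :=
  iter k (fun x j => T j (join y x)) x0.

End ImplicitFunction.

(** * Picard iteration, its limit and the dependence on parameters *)

Section Picard.
Context {R : realType} {n m : nat}.
Variables (T : 'I_m -> ('I_n + 'I_m -> R) -> R) (y0 : 'I_n -> R) (x0 : 'I_m -> R).
Variables K e : R.
Hypotheses (K1 : 1 <= K) (e0 : 0 < e).
Hypothesis Tfix : forall j, T j (join y0 x0) = x0 j.
Hypothesis Tcontr :
  forall k (r D : R) (u v : 'rV[R]_k -> 'I_n + 'I_m -> R), 0 <= r -> 0 <= D ->
    (forall i, majorized r e (fun t => u t i - join y0 x0 i)) ->
    (forall i, majorized r e (fun t => v t i - join y0 x0 i)) ->
    (forall i, majorized r D (fun t => u t i - v t i)) -> forall j,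
    majorized r (K * D) (fun t => T j (u t) - T j (v t)) /\
    ((forall t i, u t (inl i) = v t (inl i)) ->
     majorized r (D / 2) (fun t => T j (u t) - T j (v t))).

(** Parameters within [d] make the first Picard step at most [K * d = e / 2]; as each later step is
    halved, the total drift stays below [e]. *)
Let d := e / (2 * K).
Let K0 : 0 < K. Proof. exact: lt_le_trans K1. Qed.
Let d0 : 0 < d. Proof. by rewrite divr_gt0 ?mulr_gt0. Qed.
Let de : d <= e.
Proof. by rewrite ler_pdivrMr ?mulr_gt0 // ler_peMr ?(ltW e0) //; move: K1; lra. Qed.
Let Kd : K * d = e / 2. Proof. by rewrite /d; field; rewrite gt_eqF. Qed.

(** The two bounds need each other: the drift keeps the iterates where [Tcontr] applies, and the
    halved steps sum up to the next drift. *)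
Lemma picard_majorized k (r : R) (y : 'rV[R]_k -> 'I_n -> R) : 0 <= r ->
  (forall i, majorized r d (fun t => y t i - y0 i)) -> forall N,
  (forall j, majorized r (e * (1 - (2 ^+ N)^-1))
     (fun t => picard T x0 (y t) N j - x0 j)) /\
  (forall j, majorized r (e / 2 / 2 ^+ N)
     (fun t => picard T x0 (y t) N.+1 j - picard T x0 (y t) N j)).
Proof.
move=> r0 yd; have e0' := ltW e0.
have ye i : majorized r e (fun t => y t i - y0 i) by exact: majorized_le (yd i).
have lt1 N : e * (1 - (2 ^+ N)^-1) <= e.
  by rewrite ler_piMr // gerBl invr_ge0 exprn_ge0.
elim=> [|N [IH1 IH2]].
  split=> j; rewrite expr0.
    rewrite invr1 subrr mulr0.
    by apply: eq_majorized (majorized0 _ _) => // t; rewrite /= subrr.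
  have z0 (c M : R) : 0 <= M -> majorized r M (fun _ : 'rV[R]_k => c - c).
    by rewrite subrr; exact: majorized0.
  rewrite divr1 -Kd.
  (* The first step compares with the fixed point over [y0], so the parameters differ and only the
     Lipschitz clause of [Tcontr] is available. *)
  have [+ _] := Tcontr (u := fun t => join (y t) x0) (v := fun=> join y0 x0)
    r0 (ltW d0) (fun s => match s with inl i => ye i | inr i => z0 (x0 i) _ e0' end)
    (fun s => z0 _ _ e0')
    (fun s => match s with inl i => yd i | inr i => z0 (x0 i) _ (ltW d0) end) j.
  by apply: eq_majorized => t /=; rewrite Tfix.
have h j : majorized r (e * (1 - (2 ^+ N.+1)^-1))
    (fun t => picard T x0 (y t) N.+1 j - x0 j).
  apply: eq_majorized (majorized_le _ (majorizedD (IH1 j) (IH2 j))) => [t|].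
    by ring.
  rewrite exprS le_eqVlt; apply/orP; left; apply/eqP.
  by field; exact: expf_neq0.
split=> // j.
have -> : e / 2 / 2 ^+ N.+1 = e / 2 / 2 ^+ N / 2.
  by rewrite exprS; field; exact: expf_neq0.
apply: (proj2 (Tcontr (u := fun t => join (y t) (picard T x0 (y t) N.+1))
  (v := fun t => join (y t) (picard T x0 (y t) N)) r0 _ _ _ _ j)) => //.
- by rewrite !divr_ge0 // exprn_ge0.
- by case=> i; [exact: ye|exact: majorized_le (h i)].
- by case=> i; [exact: ye|exact: majorized_le (IH1 i)].
- case=> i /=; last exact: IH2.
  apply: eq_majorized (majorized0 _ _) => [t|]; first by rewrite subrr.
  by rewrite !divr_ge0 // exprn_ge0.
Qed.

(** In zero variables the norm of a constant is its absolute value; this and the next fact turn the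
    polynomial estimates into numerical ones. *)
Let le_majorized (a c : R) : `|c| <= a -> majorized 0 a (fun _ : 'rV[R]_0 => c).
Proof. by move=> ca; exact: majorized_le (majorized_cst _ _). Qed.

Let le_of_majorized (a c : R) : majorized 0 a (fun _ : 'rV[R]_0 => c) -> `|c| <= a.
Proof.
by move=> h; apply: (majorized_bound (t := 0) _ h) => -[].
Qed.

Lemma contraction_le (D : R) (u v : 'I_n + 'I_m -> R) : 0 <= D ->
  (forall i, `|u i - join y0 x0 i| <= e) ->
  (forall i, `|v i - join y0 x0 i| <= e) ->
  (forall i, `|u i - v i| <= D) -> forall j,
  `|T j u - T j v| <= K * D /\
  ((forall i, u (inl i) = v (inl i)) -> `|T j u - T j v| <= D / 2).
Proof.
move=> D0 ue ve uv j; have [h1 h2] := Tcontr (k := 0) (r := 0) (u := fun=> u)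
  (v := fun=> v) (lexx _) D0 (fun i => le_majorized (ue i))
  (fun i => le_majorized (ve i)) (fun i => le_majorized (uv i)) j.
split; first exact: le_of_majorized h1.
by move=> uvy; apply: le_of_majorized; exact: h2.
Qed.

(** The distance of two fixed points improves itself: inserting [T j (join y x')] bounds it by half
    of any previous bound plus [K * D], and iterating from the crude bound [2 * e] leaves
    [2 * K * D]. The case [D = 0] is uniqueness. *)
Lemma fixed_point_lipschitz y y' x x' (D : R) : 0 <= D ->
  (forall i, `|y i - y0 i| <= d) -> (forall i, `|y' i - y0 i| <= d) ->
  (forall i, `|y i - y' i| <= D) ->
  (forall j, `|x j - x0 j| <= e) -> (forall j, `|x' j - x0 j| <= e) ->
  (forall j, T j (join y x) = x j) -> (forall j, T j (join y' x') = x' j) ->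
  forall j, `|x j - x' j| <= 2 * K * D.
Proof.
move=> D0 yd yd' yy' xe xe' fx fx' j.
have KD : 0 <= 2 * K * D by rewrite !mulr_ge0 // ltW.
have H N : forall j, `|x j - x' j| <= 2 * K * D + 2 * e / 2 ^+ N.
  have pos N' : 0 <= 2 * e / 2 ^+ N' by rewrite divr_ge0 ?mulr_ge0 ?(ltW e0) ?exprn_ge0.
  elim: N => [|N IH] {}j.
    rewrite expr0 divr1; apply: (@le_trans _ _ (2 * e)); last by rewrite lerDr.
    rewrite (_ : x j - x' j = (x j - x0 j) - (x' j - x0 j)); last by ring.
    apply: le_trans (ler_normB _ _) _.
    by rewrite mulr_natl mulr2n lerD.
  rewrite -fx -fx'.
  rewrite (_ : _ - _ = (T j (join y x) - T j (join y x')) +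
     (T j (join y x') - T j (join y' x'))); last by ring.
  apply: le_trans (ler_normD _ _) _.
  have h1 : `|T j (join y x) - T j (join y x')| <= (2 * K * D + 2 * e / 2 ^+ N) / 2.
    apply: (proj2 (contraction_le _ _ _ _ j)) => //.
    - by rewrite addr_ge0.
    - by case=> i //=; exact: le_trans (yd i) de.
    - by case=> i //=; exact: le_trans (yd i) de.
    - by case=> i //=; rewrite subrr normr0 addr_ge0.
  have h2 : `|T j (join y x') - T j (join y' x')| <= K * D.
    apply: (proj1 (contraction_le _ _ _ _ j)) => //.
    - by case=> i //=; exact: le_trans (yd i) de.
    - by case=> i //=; exact: le_trans (yd' i) de.
    - by case=> i //=; rewrite subrr normr0.
  apply: le_trans (lerD h1 h2) _; rewrite exprS le_eqVlt; apply/orP; left.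
  by apply/eqP; field; exact: expf_neq0.
rewrite -subr_le0; apply: (@le_geometric0 _ _ (2 * e)) => N.
by rewrite lerBlDl; exact: H.
Qed.

Definition picard_lim (y : 'I_n -> R) (j : 'I_m) : R :=
  limn (fun k => picard T x0 y k j).

Lemma picard_le y : (forall i, `|y i - y0 i| <= d) -> forall N j,
  `|picard T x0 y N j - x0 j| <= e /\
  `|picard T x0 y N.+1 j - picard T x0 y N j| <= e / 2 / 2 ^+ N.
Proof.
move=> yd N j; have [h1 h2] := @picard_majorized 0 0 (fun=> y) (lexx _)
  (fun i => le_majorized (yd i)) N.
split; last exact: le_of_majorized (h2 j).
apply: le_trans (le_of_majorized (h1 j)) _.
by rewrite ler_piMr ?(ltW e0) // gerBl invr_ge0 exprn_ge0.
Qed.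

Lemma picardE y N j : picard T x0 y N j =
  x0 j + series (fun k => picard T x0 y k.+1 j - picard T x0 y k j) N.
Proof. by rewrite /series /= telescope_sumr //= addrC subrK. Qed.

Lemma picard_series_cvg j y : (forall i, `|y i - y0 i| <= d) ->
  series (fun k => picard T x0 y k.+1 j - picard T x0 y k j) @ \oo -->
  picard_lim y j - x0 j.
Proof.
move=> yd; have sc : cvgn (series (fun k => picard T x0 y k.+1 j - picard T x0 y k j)).
  by apply: (@geometric_cvg _ _ (e / 2)) => N; case: (picard_le yd N j).
suff -> : picard_lim y j - x0 j =
  limn (series (fun k => picard T x0 y k.+1 j - picard T x0 y k j)) by [].
rewrite /picard_lim; under eq_fun do rewrite picardE.
by rewrite (cvg_lim _ (cvgD (cvg_cst (x0 j)) sc)) // addrAC subrr add0r.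
Qed.

Lemma picard_lim_dist y N j : (forall i, `|y i - y0 i| <= d) ->
  `|picard_lim y j - picard T x0 y N j| <= e / 2 ^+ N.
Proof.
move=> yd; rewrite picardE opprD addrA.
have -> : e / 2 ^+ N = 2 * (e / 2) / 2 ^+ N.
  by field; exact: expf_neq0.
apply: geometric_tail_le; last exact: picard_series_cvg.
move=> k /=.
by case: (picard_le yd k j).
Qed.

Lemma picard_lim_near y j : (forall i, `|y i - y0 i| <= d) ->
  `|picard_lim y j - x0 j| <= e.
Proof. by move=> /(picard_lim_dist 0 j); rewrite expr0 divr1. Qed.

Lemma picard_lim_fixed y j : (forall i, `|y i - y0 i| <= d) ->
  T j (join y (picard_lim y)) = picard_lim y j.
Proof.
move=> yd; apply/eqP; rewrite -subr_eq0 -normr_le0.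
(* [K * e] comes from moving the argument of [T] to the iterate of rank [N], and [e] from the
   distance of the next iterate to the limit; both decay like [2 ^- N]. *)
apply: (@le_geometric0 _ _ (K * e + e)) => N.
rewrite (_ : _ - _ = (T j (join y (picard_lim y)) - T j (join y (picard T x0 y N)))
  - (picard_lim y j - picard T x0 y N.+1 j)); last by rewrite /=; ring.
apply: le_trans (ler_normB _ _) _; rewrite mulrDl lerD //.
  rewrite -mulrA; apply: (proj1 (contraction_le _ _ _ _ j)).
  - by rewrite divr_ge0 ?(ltW e0) ?exprn_ge0.
  - case=> i /=; first exact: le_trans (yd i) de.
    exact: picard_lim_near.
  - case=> i /=; first exact: le_trans (yd i) de.
    by case: (picard_le yd N i).
  - case=> i /=; last exact: picard_lim_dist.
    by rewrite subrr normr0 divr_ge0 ?(ltW e0) ?exprn_ge0.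
apply: le_trans (picard_lim_dist _ _ yd) _.
rewrite exprS invfM ler_wpM2l ?(ltW e0) // ler_piMl ?invr_ge0 ?exprn_ge0 //.
by rewrite invf_le1 // ler1n.
Qed.

(** The translated family [y + t - y0] is a polynomial in [t] of norm at most [|y - y0| + r]. As
    long as this is below [d], the Picard bounds hold around [y] exactly as around [y0]. *)
Lemma picard_lim_analytic y : (forall i, `|y i - y0 i| < d) ->
  exists2 r : R, 0 < r & forall j,
  exists (c : {ffun 'I_n -> nat} -> R) (M : R), forall t : 'rV[R]_n,
    (forall i, `|t 0 i| <= r) ->
    (forall N, box_sum (fun alpha => `|multi_power t alpha * c alpha|) N <= M)
    /\ box_sum (fun alpha => multi_power t alpha * c alpha) @ \oo -->
       picard_lim (fun i => y i + t 0 i) j.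
Proof.
move=> yd.
have [r r0 rP] : exists2 r : R, 0 < r & forall i, `|y i - y0 i| + r <= d.
  have [a ad aP] : exists2 a, a < d & forall i, `|y i - y0 i| <= a.
    exists (\big[Num.max/0]_i `|y i - y0 i|); last by move=> i; exact: le_bigmax.
    by apply/bigmax_ltP; split.
  exists (d - a); first by rewrite subr_gt0.
  by move=> i; rewrite addrCA gerDl subr_le0.
have yt i : majorized r d (fun t : 'rV[R]_n => y i + t 0 i - y0 i).
  apply: eq_majorized (majorized_le (rP i) (majorizedD (majorized_cst r _)
    (majorized_var r i))) => t.
  by rewrite addrAC.
exists r => // j.
(* Taking [x0 j] as zeroth term makes the partial sums of [f] the Picard iterates themselves,
   shifted by one rank. *)
pose f k (t : 'rV[R]_n) := if k is k'.+1 then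
   picard T x0 (fun i => y i + t 0 i) k'.+1 j - picard T x0 (fun i => y i + t 0 i) k' j
   else x0 j.
have fM k : majorized r ((e + `|x0 j|) / 2 ^+ k) (f k).
  case: k => [|k] /=.
    by apply: majorized_le (majorized_cst _ _); rewrite expr0 divr1 lerDr ltW.
  have [_ /(_ j)] := picard_majorized (ltW r0) yt k.
  apply: majorized_le; rewrite exprS invfM mulrA ler_wpM2r ?invr_ge0 ?exprn_ge0 //.
  by rewrite ler_wpM2r // lerDl.
have [c cP] := power_series_of_majorized r0 fM.
exists c, (2 * (e + `|x0 j|)) => t tr; apply: cP => //.
have ytd i : `|y i + t 0 i - y0 i| <= d.
  by apply: majorized_bound (yt i).
rewrite -(cvg_shiftS (series _)) /=.
have fl : (fun k => x0 j + series (fun k =>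
      picard T x0 (fun i => y i + t 0 i) k.+1 j -
      picard T x0 (fun i => y i + t 0 i) k j) k) @ \oo -->
    x0 j + (picard_lim (fun i => y i + t 0 i) j - x0 j).
  by apply: cvgD; [exact: cvg_cst|exact: picard_series_cvg].
rewrite addrCA subrr addr0 in fl; apply: (cvg_trans _ fl).
apply: near_eq_cvg; apply: nearW => k /=.
by rewrite /series /= big_nat_recl.
Qed.

End Picard.

(** The second clause compares [g y] with any fixed point over [y']: for [D = 0] it is uniqueness,
    against the base point it bounds the variation of [g], and against other points it yields
    continuity. *)
Theorem analytic_implicit_function {R : realType} {n m : nat}
    (T : 'I_m -> ('I_n + 'I_m -> R) -> R) (y0 : 'I_n -> R) (x0 : 'I_m -> R) :
  (forall j, exists l, sdiff (join y0 x0) (T j) l /\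
     forall du, (forall i, du (inl i) = 0) -> l du = 0) ->
  (forall j, T j (join y0 x0) = x0 j) ->
  exists (d e L : R) (g : ('I_n -> R) -> 'I_m -> R),
  [/\ 0 < d, 0 < e & 0 <= L] /\
  [/\ forall y, (forall i, `|y i - y0 i| < d) -> forall j,
        `|g y j - x0 j| <= e /\ T j (join y (g y)) = g y j,
      forall y y' x' D, 0 <= D ->
        (forall i, `|y i - y0 i| < d) -> (forall i, `|y' i - y0 i| < d) ->
        (forall i, `|y i - y' i| <= D) -> (forall j, `|x' j - x0 j| <= e) ->
        (forall j, T j (join y' x') = x' j) ->
        forall j, `|g y j - x' j| <= L * D &
      forall y, (forall i, `|y i - y0 i| < d) ->
        exists2 r : R, 0 < r & forall j,
        exists (c : {ffun 'I_n -> nat} -> R) (M : R), forall t : 'rV[R]_n,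
          (forall i, `|t 0 i| <= r) ->
          (forall N, box_sum (fun alpha => `|multi_power t alpha * c alpha|) N <= M)
          /\ box_sum (fun alpha => multi_power t alpha * c alpha) @ \oo -->
             g (fun i => y i + t 0 i) j].
Proof.
move=> TP Tfix; have [l lP] := choice TP.
have Tdiff j : sdiff (join y0 x0) (T j) (l j) by case: (lP j).
have l0 j du : (forall i, du (inl i) = 0) -> l j du = 0 by case: (lP j) => _; apply.
have [K [e [K1 e0 Tc]]] := uniform_contraction Tdiff l0.
have K0 : 0 < K by exact: lt_le_trans K1.
exists (e / (2 * K)), e, (2 * K), (picard_lim T x0); split; split=> //.
- by rewrite divr_gt0 ?mulr_gt0.
- by rewrite mulr_ge0 ?ltW.
- move=> y yd j; have yd' i := ltW (yd i).
  by split; [exact: (picard_lim_near K1 e0 Tfix Tc)|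
             exact: (picard_lim_fixed K1 e0 Tfix Tc)].
- move=> y y' x' D D0 yd yd' yy' xe fx.
  have ydw i := ltW (yd i); have ydw' i := ltW (yd' i).
  apply: (fixed_point_lipschitz K1 e0 Tc D0 ydw ydw' yy' _ xe _ fx) => j.
    exact: (picard_lim_near K1 e0 Tfix Tc).
  exact: (picard_lim_fixed K1 e0 Tfix Tc).
- by move=> y yd; exact: (picard_lim_analytic K1 e0 Tfix Tc).
Qed.

(** Scalar series for the components are reassembled along the vectors [e']; the bound [M j] of each
    component, weighted by the norm of [e' j], gives absolute convergence. *)
Lemma analytic_at_coord {R : realType} {V W : normedModType R} {n m : nat}
    (f : V -> W) (a : V) (e : 'I_n -> V) (e' : 'I_m -> W)
    (F : 'rV[R]_n -> 'I_m -> R) (r : R) : 0 < r ->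
  bijective (fun t : 'rV[R]_n => \sum_(i < n) t 0 i *: e i) ->
  (forall t : 'rV[R]_n, (forall i, `|t 0 i| < r) ->
     f (a + \sum_(i < n) t 0 i *: e i) = \sum_(j < m) F t j *: e' j) ->
  (forall j, exists (c : {ffun 'I_n -> nat} -> R) (M : R), forall t : 'rV[R]_n,
     (forall i, `|t 0 i| < r) ->
     (forall N, box_sum (fun alpha => `|multi_power t alpha * c alpha|) N <= M)
     /\ box_sum (fun alpha => multi_power t alpha * c alpha) @ \oo --> F t j) ->
  analytic_at f a.
Proof.
move=> r0 ebij fF /choice[c /choice[M cM]].
pose C alpha := \sum_j c j alpha *: e' j.
exists n, e, C, r; split=> // t tr; split.
  apply: (@box_sum_cvg _ _ _ (\sum_j M j * `|e' j|)) => // N.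
  apply: (@le_trans _ _ (\sum_j
    box_sum (fun alpha => `|multi_power t alpha * c j alpha|) N * `|e' j|)).
    rewrite /box_sum; under [leRHS]eq_bigr do rewrite mulr_suml.
    rewrite exchange_big /=; apply: ler_sum => k _.
    rewrite scaler_sumr; apply: le_trans (ler_norm_sum _ _ _) _.
    by apply: ler_sum => j _; rewrite scalerA normrZ.
  by apply: ler_sum => j _; rewrite ler_wpM2r //; case: (cM j t tr).
rewrite fF //.
have -> : box_sum (fun alpha => multi_power t alpha *: C alpha) =
    (fun N => \sum_j box_sum (fun alpha => multi_power t alpha * c j alpha) N *: e' j).
  apply/funext => N; rewrite /box_sum; under [RHS]eq_bigr do rewrite scaler_suml.
  rewrite exchange_big /=; apply: eq_bigr => k _.
  by rewrite scaler_sumr; apply: eq_bigr => j _; rewrite scalerA.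
by apply: cvg_sum_seq => j; apply: cvgZr_tmp; case: (cM j t tr).
Qed.

(** Linearity is assumed of [coord] only; that of its inverse follows by comparing coordinates. *)
Lemma coord_sum {R : realType} {V : lmodType R} {n : nat} (coord : V -> 'I_n -> R)
    (uncoord : ('I_n -> R) -> V) (v : 'I_n -> R) :
  (forall u, coord (uncoord u) =1 u) ->
  (forall x, uncoord (coord x) = x) ->
  (forall k x y i, coord (k *: x + y) i = k * coord x i + coord y i) ->
  uncoord v = \sum_(i < n) v i *: uncoord (fun j => (j == i)%:R).
Proof.
move=> uK cK lin; have c0 i : coord 0 i = 0.
  by have := lin (-1) 0 0 i; rewrite scaler0 addr0 mulN1r addNr.
have cinj x y : coord x =1 coord y -> x = y.
  by move=> /funext xy; rewrite -(cK x) xy cK.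
apply: cinj => i; rewrite uK.
have -> : forall s : seq 'I_n, coord (\sum_(j <- s) v j *: uncoord (fun k => (k == j)%:R)) i
   = \sum_(j <- s) v j * (i == j)%:R.
  by elim=> [|j s IH]; rewrite ?big_nil // !big_cons lin uK IH.
rewrite (bigD1 i) //= eqxx mulr1 big1 ?addr0 // => j.
by rewrite eq_sym => /negbTE ->; rewrite mulr0.
Qed.

Lemma coord_bij {R : realType} {V : lmodType R} {n : nat} (coord : V -> 'I_n -> R)
    (uncoord : ('I_n -> R) -> V) :
  (forall u, coord (uncoord u) =1 u) ->
  (forall x, uncoord (coord x) = x) ->
  (forall k x y i, coord (k *: x + y) i = k * coord x i + coord y i) ->
  bijective (fun t : 'rV[R]_n =>
    \sum_(i < n) t 0 i *: uncoord (fun j => (j == i)%:R)).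
Proof.
move=> uK cK lin; exists (fun x => \row_i coord x i) => [t|x].
  by apply/rowP => i; rewrite -(coord_sum (fun i => t 0 i) uK cK lin) mxE uK.
rewrite -(coord_sum _ uK cK lin) -[RHS]cK; congr uncoord.
by apply/funext => i; rewrite mxE.
Qed.

(** * The normal form equations *)

Lemma det_mx22 {R : comPzRingType} (A : 'M[R]_2) :
  \det A = A 0 0 * A 1 1 - A 0 1 * A 1 0.
Proof.
rewrite (expand_det_row _ ord0) !big_ord_recl big_ord0 addr0.
rewrite /cofactor !det_mx11 !mxE /= expr0 expr1 mul1r mulN1r mulrN.
by congr (A _ _ * A _ _ - A _ _ * A _ _); exact/val_inj.
Qed.

Lemma mulmx2E {R : realType} (A : 'M[R]_2) (z : 'cV[R]_2) i :
  (A *m z) i 0 = A i 0 * z 0 0 + A i 1 * z 1 0.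
Proof.
rewrite mxE !big_ord_recl big_ord0 addr0; congr (_ + A i _ * z _ 0);
  exact/val_inj.
Qed.

Notation ord12 k := (@Ordinal 12 k isT).

Lemma forall_ord12 (P : 'I_12 -> Prop) :
  (P (ord12 0) /\ P (ord12 1) /\ P (ord12 2) /\ P (ord12 3)) ->
  (P (ord12 4) /\ P (ord12 5) /\ P (ord12 6) /\ P (ord12 7)) ->
  (P (ord12 8) /\ P (ord12 9) /\ P (ord12 10) /\ P (ord12 11)) ->
  forall k, P k.
Proof.
move=> [? [? [? ?]]] [? [? [? ?]]] [? [? [? ?]]] [k hk].
move: k hk; do 12 (case; first by move=> hk; rewrite (bool_irrelevance hk isT)).
by [].
Qed.

Lemma forall_ord2 (P : 'I_2 -> Prop) : P 0 -> P 1 -> forall k, P k.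
Proof.
move=> P0 P1 [[|[|//]] hk].
- by rewrite (_ : Ordinal hk = 0) //; exact/val_inj.
- by rewrite (_ : Ordinal hk = 1) //; exact/val_inj.
Qed.

Lemma forall_ord5 (P : 'I_5 -> Prop) :
  P 0 -> P 1 -> P 2 -> P 3 -> P 4 -> forall k, P k.
Proof.
move=> P0 P1 P2 P3 P4 [[|[|[|[|[|//]]]]] hk].
- by rewrite (_ : Ordinal hk = 0) //; exact/val_inj.
- by rewrite (_ : Ordinal hk = 1) //; exact/val_inj.
- by rewrite (_ : Ordinal hk = 2) //; exact/val_inj.
- by rewrite (_ : Ordinal hk = 3) //; exact/val_inj.
- by rewrite (_ : Ordinal hk = 4) //; exact/val_inj.
Qed.

Lemma forall_ord6 (P : 'I_6 -> Prop) :
  P 0 -> P 1 -> P 2 -> P 3 -> P 4 -> P 5 -> forall k, P k.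
Proof.
move=> P0 P1 P2 P3 P4 P5 [[|[|[|[|[|[|//]]]]]] hk].
- by rewrite (_ : Ordinal hk = 0) //; exact/val_inj.
- by rewrite (_ : Ordinal hk = 1) //; exact/val_inj.
- by rewrite (_ : Ordinal hk = 2) //; exact/val_inj.
- by rewrite (_ : Ordinal hk = 3) //; exact/val_inj.
- by rewrite (_ : Ordinal hk = 4) //; exact/val_inj.
- by rewrite (_ : Ordinal hk = 5) //; exact/val_inj.
Qed.

(** * Twelve coordinates on parameters and on quadratic fields *)

Section Coordinates.
Context {R : realType}.
Implicit Types (p : affine R * R * 'rV[R]_5) (Y : 'M[R]_(2, 6)) (v w : 'I_12 -> R).

Definition param_coord p (k : 'I_12) : R :=
  [:: p.1.1.1 0 0; p.1.1.1 0 1; p.1.1.1 1 0; p.1.1.1 1 1;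
      p.1.1.2 0 0; p.1.1.2 1 0; p.1.2;
      p.2 0 0; p.2 0 1; p.2 0 2; p.2 0 3; p.2 0 4]`_k.

Definition param_of v : affine R * R * 'rV[R]_5 :=
  (\matrix_(i < 2, j < 2) (nth [::] [:: [:: v (ord12 0); v (ord12 1)];
                                        [:: v (ord12 2); v (ord12 3)]] i)`_j,
   vec2 (v (ord12 4)) (v (ord12 5)), v (ord12 6),
   \row_(j < 5) [:: v (ord12 7); v (ord12 8); v (ord12 9); v (ord12 10);
                    v (ord12 11)]`_j).

Definition field_coord Y (k : 'I_12) : R :=
  [:: Y 0 0; Y 0 1; Y 0 2; Y 0 3; Y 0 4; Y 0 5;
      Y 1 0; Y 1 1; Y 1 2; Y 1 3; Y 1 4; Y 1 5]`_k.

Definition field_of v : 'M[R]_(2, 6) :=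
  \matrix_(i < 2, j < 6) (nth [::]
    [:: [:: v (ord12 0); v (ord12 1); v (ord12 2); v (ord12 3); v (ord12 4); v (ord12 5)];
        [:: v (ord12 6); v (ord12 7); v (ord12 8); v (ord12 9); v (ord12 10);
            v (ord12 11)]] i)`_j.

Lemma param_ofK v : param_coord (param_of v) =1 v.
Proof. by apply: forall_ord12; rewrite /param_coord /= !mxE. Qed.

Lemma field_ofK v : field_coord (field_of v) =1 v.
Proof. by apply: forall_ord12; rewrite /field_coord /= !mxE. Qed.

Lemma param_coordK p : param_of (param_coord p) = p.
Proof.
case: p => [[[A b] rho] l]; congr (_, _, _, _).
- apply/matrixP => -[[|[|//]]] hi [[|[|//]]] hj; rewrite mxE /param_coord /=;
    by congr (A _ _); exact/val_inj.
- exact: vec2K.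
- apply/rowP => -[[|[|[|[|[|//]]]]]] hj; rewrite mxE /param_coord /=;
    by congr (l _ _); exact/val_inj.
Qed.

Lemma field_coordK Y : field_of (field_coord Y) = Y.
Proof.
by apply/matrixP => -[[|[|//]]] hi [[|[|[|[|[|[|//]]]]]]] hj;
  rewrite mxE /field_coord /=; congr (Y _ _); exact/val_inj.
Qed.

Lemma param_coord_linear c p q k :
  param_coord (c *: p + q) k = c * param_coord p k + param_coord q k.
Proof.
by move: k; apply: forall_ord12; rewrite /param_coord /= !mxE.
Qed.

Lemma field_coord_linear c Y Z k :
  field_coord (c *: Y + Z) k = c * field_coord Y k + field_coord Z k.
Proof.
by move: k; apply: forall_ord12; rewrite /field_coord /= !mxE.
Qed.

(** Distances on products and matrices are maxima, so a ball is a box in the twelve coordinates. *)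
Lemma param_ballP p q r : 0 < r ->
  ball p r q <-> forall k, `|param_coord p k - param_coord q k| < r.
Proof.
move=> r0; split.
  case=> -[[[_ A] [_ b]] rho] [_ l].
  by apply: forall_ord12; rewrite /param_coord /=;
    repeat first [exact: A|exact: b|exact: rho|exact: l|split].
move=> pq; split; [split; [split|]|].
- split=> //; apply: forall_ord2; apply: forall_ord2; [exact: (pq (ord12 0))|
    exact: (pq (ord12 1))|exact: (pq (ord12 2))|exact: (pq (ord12 3))].
- split=> // i j; rewrite (ord1 j); move: i.
  by apply: forall_ord2; [exact: (pq (ord12 4))|exact: (pq (ord12 5))].
- exact: (pq (ord12 6)).
- split=> // i; rewrite (ord1 i); apply: forall_ord5; [exact: (pq (ord12 7))|
    exact: (pq (ord12 8))|exact: (pq (ord12 9))|exact: (pq (ord12 10))|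
    exact: (pq (ord12 11))].
Qed.

Lemma field_ballP Y Z r : 0 < r ->
  ball Y r Z <-> forall k, `|field_coord Y k - field_coord Z k| < r.
Proof.
move=> r0; split.
  case=> _ YZ.
  by apply: forall_ord12; rewrite /field_coord /=; repeat first [exact: YZ|split].
move=> YZ; split=> //; apply: forall_ord2; apply: forall_ord6;
  [exact: (YZ (ord12 0))|exact: (YZ (ord12 1))|exact: (YZ (ord12 2))|
   exact: (YZ (ord12 3))|exact: (YZ (ord12 4))|exact: (YZ (ord12 5))|
   exact: (YZ (ord12 6))|exact: (YZ (ord12 7))|exact: (YZ (ord12 8))|
   exact: (YZ (ord12 9))|exact: (YZ (ord12 10))|exact: (YZ (ord12 11))].
Qed.

End Coordinates.

(** * The polynomial system equivalent to the normal form *)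

Section Equations.
Context {R : realType}.
Implicit Types (p : affine R * R * 'rV[R]_5) (Y : 'M[R]_(2, 6)) (v w : 'I_12 -> R).

(* Coefficients of rho X_lambda(A z + b) - A Y(z): clearing the inverse of A
   makes the equation Y = S_map p polynomial. *)
Definition normal_form_eqs v w : seq R :=
  let a11 := v (ord12 0) in let a12 := v (ord12 1) in
  let a21 := v (ord12 2) in let a22 := v (ord12 3) in
  let b1 := v (ord12 4) in let b2 := v (ord12 5) in let rho := v (ord12 6) in
  let B := v (ord12 7) in let mu2 := v (ord12 8) in let mu3 := v (ord12 9) in
  let k := v (ord12 10) + B * v (ord12 11) in
  let s := (1 - 2 * B) * v (ord12 11) in
  [:: rho * (- b2 + B * (b1 * b1) + mu2 * (b2 * b2) + k * b1)
        - (a11 * w (ord12 0) + a12 * w (ord12 6));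
      rho * (- a21 + 2 * (B * (a11 * b1)) + 2 * (mu2 * (a21 * b2)) + k * a11)
        - (a11 * w (ord12 1) + a12 * w (ord12 7));
      rho * (- a22 + 2 * (B * (a12 * b1)) + 2 * (mu2 * (a22 * b2)) + k * a12)
        - (a11 * w (ord12 2) + a12 * w (ord12 8));
      rho * (B * (a11 * a11) + mu2 * (a21 * a21))
        - (a11 * w (ord12 3) + a12 * w (ord12 9));
      rho * (2 * (B * (a11 * a12)) + 2 * (mu2 * (a21 * a22)))
        - (a11 * w (ord12 4) + a12 * w (ord12 10));
      rho * (B * (a12 * a12) + mu2 * (a22 * a22))
        - (a11 * w (ord12 5) + a12 * w (ord12 11));
      rho * (b1 + b1 * b2 + mu3 * (b2 * b2) + s * b2)
        - (a21 * w (ord12 0) + a22 * w (ord12 6));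
      rho * (a11 + (a11 * b2 + a21 * b1) + 2 * (mu3 * (a21 * b2)) + s * a21)
        - (a21 * w (ord12 1) + a22 * w (ord12 7));
      rho * (a12 + (a12 * b2 + a22 * b1) + 2 * (mu3 * (a22 * b2)) + s * a22)
        - (a21 * w (ord12 2) + a22 * w (ord12 8));
      rho * (a11 * a21 + mu3 * (a21 * a21))
        - (a21 * w (ord12 3) + a22 * w (ord12 9));
      rho * (a11 * a22 + a12 * a21 + 2 * (mu3 * (a21 * a22)))
        - (a21 * w (ord12 4) + a22 * w (ord12 10));
      rho * (a12 * a22 + mu3 * (a22 * a22))
        - (a21 * w (ord12 5) + a22 * w (ord12 11))].

Lemma field_of0E v x y : quad_field (field_of v) (vec2 x y) 0 0 =
  v (ord12 0) + v (ord12 1) * x + v (ord12 2) * y + v (ord12 3) * x ^+ 2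
  + v (ord12 4) * (x * y) + v (ord12 5) * y ^+ 2.
Proof. by rewrite quad_fieldE !mxE. Qed.

Lemma field_of1E v x y : quad_field (field_of v) (vec2 x y) 1 0 =
  v (ord12 6) + v (ord12 7) * x + v (ord12 8) * y + v (ord12 9) * x ^+ 2
  + v (ord12 10) * (x * y) + v (ord12 11) * y ^+ 2.
Proof. by rewrite quad_fieldE !mxE. Qed.

(** Since nothing is inverted, this is a polynomial identity valid for every [p], even with a
    singular linear part. *)
Lemma normal_form_eqsE p Y z :
  p.1.2 *: X p.2 (affine_map p.1.1 z) - p.1.1.1 *m quad_field Y z =
  quad_field (field_of (fun k => (normal_form_eqs (param_coord p) (field_coord Y))`_k)) z.
Proof.
rewrite -(vec2K z); move: (z 0 0) (z 1 0) => x y.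
have affE i : affine_map p.1.1 (vec2 x y) i 0 =
    p.1.1.1 i 0 * x + p.1.1.1 i 1 * y + p.1.1.2 i 0.
  by rewrite [LHS]mxE mulmx2E !mxE.
have subE (u w : 'cV[R]_2) i : (p.1.2 *: u - w) i 0 = p.1.2 * u i 0 - w i 0.
  by rewrite !mxE.
apply: col2E; rewrite ?field_of0E ?field_of1E subE mulmx2E !quad_fieldE;
  rewrite /X [vec2 _ _ _ _]mxE !affE /normal_form_eqs /param_coord /field_coord /=.
  ring.
ring.
Qed.

(** Multiplication by the linear part is cancelled in both directions, and a quadratic field
    determines its coefficients by [quad_coefK]. *)
Lemma S_mapP p Y : p.1.1.1 \in unitmx ->
  Y = S_map p <->
  forall k : 'I_12, (normal_form_eqs (param_coord p) (field_coord Y))`_k = 0.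
Proof.
move=> Au; set F := normal_form_eqs _ _; set M := field_of (fun k => F`_k).
have E z : p.1.2 *: X p.2 (affine_map p.1.1 z) - p.1.1.1 *m quad_field Y z =
    quad_field M z by exact: normal_form_eqsE.
have M0 : quad_field (0 : 'M[R]_(2, 6)) =1 fun=> 0.
  by move=> z; rewrite /quad_field mul0mx.
split=> [YS k|F0].
  have : M = 0.
    apply: (can_inj (@quad_coefK R)); apply/funext => z; rewrite -E M0 YS.
    rewrite quad_field_S_map /represented /pullback -scalemxAr.
    by rewrite mulKVmx // subrr.
  by move=> M0'; rewrite -[LHS](field_ofK (fun k => F`_k)) -/M M0' /field_coord;
    move: k; apply: forall_ord12; rewrite /= !mxE.
have MZ : M = 0.
  rewrite -[RHS]field_coordK; congr field_of; apply/funext => k; rewrite F0.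
  by move: k; apply: forall_ord12; rewrite /field_coord /= !mxE.
apply: (can_inj (@quad_coefK R)); apply/funext => z.
rewrite quad_field_S_map /represented /pullback scalemxAr.
move: (E z); rewrite MZ M0 => /eqP; rewrite subr_eq0 => /eqP ->.
by rewrite mulKmx.
Qed.

End Equations.

(** * The two preconditioned maps and their differentials *)

Section Newton.
Context {R : realType}.
Implicit Types (v w : 'I_12 -> R).

Definition param0 : affine R * R * 'rV[R]_5 := (affine_id, 1, 0).

Definition vparam0 (k : 'I_12) : R := [:: 1; 0; 0; 1; 0; 0; 1; 0; 0; 0; 0; 0]`_k.
Definition vfield0 (k : 'I_12) : R := [:: 0; 0; -1; 0; 0; 0; 0; 1; 0; 0; 1; 0]`_k.

Lemma param_coord0 : param_coord param0 = vparam0.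
Proof.
by apply/funext; apply: forall_ord12; rewrite /param_coord /vparam0 /= !mxE.
Qed.

Lemma field_coord0 : field_coord (quad_coef (X 0)) = vfield0.
Proof.
suff -> : X 0 = quad_field (field_of vfield0).
  by rewrite quad_coefK; apply/funext; exact: field_ofK.
apply/funext => z; rewrite -(vec2K z); apply: col2E.
  by rewrite field_of0E /vfield0 /= !mxE /=; ring.
by rewrite field_of1E /vfield0 /= !mxE /=; ring.
Qed.

(* v - L^-1 F, where L is the differential at param0 of v |-> normal_form_eqs v w. *)
Definition newton_step v (F : nat -> R) : seq R :=
  let s := (F 7%N + F 0%N - F 2%N) * 2^-1 in
  [:: v (ord12 0) - (F 10%N - s); v (ord12 1) + F 4%N; v (ord12 2) - F 9%N;
      v (ord12 3) - (F 10%N - F 7%N - F 0%N); v (ord12 4) - F 6%N;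
      v (ord12 5) + F 0%N; v (ord12 6) - s; v (ord12 7) - F 3%N;
      v (ord12 8) - F 5%N; v (ord12 9) - (F 11%N + F 4%N);
      v (ord12 10) - (F 1%N + F 9%N - F 4%N);
      v (ord12 11) - (F 8%N + F 4%N - F 6%N - F 9%N)].

Definition newton v w : seq R := newton_step v (nth 0 (normal_form_eqs v w)).

(** This is the Newton step in [w]: the equations contain [w] through the linear part of the affine
    map applied to it with a minus sign, so at the identity their differential in [w] is minus the
    identity. *)
Definition residual_step w (F : nat -> R) : seq R :=
  [:: w (ord12 0) + F 0%N; w (ord12 1) + F 1%N; w (ord12 2) + F 2%N;
      w (ord12 3) + F 3%N; w (ord12 4) + F 4%N; w (ord12 5) + F 5%N;
      w (ord12 6) + F 6%N; w (ord12 7) + F 7%N; w (ord12 8) + F 8%N;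
      w (ord12 9) + F 9%N; w (ord12 10) + F 10%N; w (ord12 11) + F 11%N].

Definition residual v w : seq R := residual_step w (nth 0 (normal_form_eqs v w)).

(** The correction is an invertible linear image of [F], so it vanishes only with [F]; [lra] solves
    the triangular-like system. *)
Lemma newton_stepP v (F : nat -> R) :
  (forall k : 'I_12, (newton_step v F)`_k = v k) <-> forall k : 'I_12, F k = 0.
Proof.
split=> H; have := (H (ord12 0), H (ord12 1), H (ord12 2), H (ord12 3),
    H (ord12 4), H (ord12 5), H (ord12 6), H (ord12 7), H (ord12 8), H (ord12 9),
    H (ord12 10), H (ord12 11));
  rewrite /= => -[[[[[[[[[[[h0 h1] h2] h3] h4] h5] h6] h7] h8] h9] h10] h11];
  by apply: forall_ord12; rewrite /=; repeat split; lra.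
Qed.

Lemma residual_stepE w (F : nat -> R) (k : 'I_12) :
  (residual_step w F)`_k = w k + F k.
Proof. by move: k; apply: forall_ord12. Qed.

Lemma residual_stepP w (F : nat -> R) :
  (forall k : 'I_12, (residual_step w F)`_k = w k) <-> forall k : 'I_12, F k = 0.
Proof.
by split=> H k; have := H k; rewrite residual_stepE;
  [move=> h; apply: (addrI (w k)); rewrite addr0|
  move=> ->; rewrite addr0].
Qed.

Lemma normal_form_eqs0 (k : 'I_12) : (normal_form_eqs vparam0 vfield0)`_k = 0.
Proof.
move: k; apply: forall_ord12; rewrite /normal_form_eqs /vparam0 /vfield0 /=;
  by repeat split; ring.
Qed.

(* The differential of normal_form_eqs at (vparam0, vfield0). *)
Definition normal_form_lin v w : seq R :=
  [:: - v (ord12 5) - w (ord12 0);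
      - v (ord12 2) - v (ord12 1) + v (ord12 10) - w (ord12 1);
      v (ord12 0) - v (ord12 3) - v (ord12 6) - w (ord12 2);
      v (ord12 7) - w (ord12 3);
      - v (ord12 1) - w (ord12 4);
      v (ord12 8) - w (ord12 5);
      v (ord12 4) - w (ord12 6);
      v (ord12 0) + v (ord12 5) - v (ord12 3) + v (ord12 6) - w (ord12 7);
      v (ord12 1) + v (ord12 4) + v (ord12 2) + v (ord12 11) - w (ord12 8);
      v (ord12 2) - w (ord12 9);
      v (ord12 0) + v (ord12 6) - w (ord12 10);
      v (ord12 1) + v (ord12 9) - w (ord12 11)].

Ltac solve_sdiff := repeat first [apply: sdiff_cst | apply: sdiff_var | apply: sdiffD
  | apply: sdiffN | apply: sdiffM].

Lemma eq_sdiff {I : Type} (u0 : I -> R) h l m :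
  sdiff u0 h l -> l =1 m -> sdiff u0 h m.
Proof. by move=> hl /funext <-. Qed.

(** The index maps [a] and [b] leave open which block plays the parameters, so one computation
    serves both implicit function problems. *)
Lemma normal_form_sdiff {I : Type} (u0 : I -> R) (a b : 'I_12 -> I) :
  (forall i, u0 (a i) = vparam0 i) -> (forall i, u0 (b i) = vfield0 i) ->
  forall k : 'I_12,
  sdiff u0 (fun u => (normal_form_eqs (fun i => u (a i)) (fun i => u (b i)))`_k)
    (fun du => (normal_form_lin (fun i => du (a i)) (fun i => du (b i)))`_k).
Proof.
move=> ua ub; apply: forall_ord12; rewrite /normal_form_eqs /normal_form_lin /=;
  repeat (match goal with |- _ /\ _ => split end);
  (apply: eq_sdiff; [solve_sdiff|
     move=> du; rewrite /= !ua ?ub /vparam0 /vfield0 /=; ring]).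
Qed.

(** The step is linear in [v] and [F] together, hence it is its own differential. *)
Lemma newton_step_sdiff {I : Type} (u0 : I -> R) (a : 'I_12 -> I)
    (F lF : nat -> (I -> R) -> R) :
  (forall k : 'I_12, sdiff u0 (F k) (lF k)) -> forall k : 'I_12,
  sdiff u0 (fun u => (newton_step (fun i => u (a i)) (F ^~ u))`_k)
    (fun du => (newton_step (fun i => du (a i)) (lF ^~ du))`_k).
Proof.
move=> HF.
have s0 : sdiff u0 (fun u => (F 7%N u + F 0%N u - F 2%N u) * 2^-1)
    (fun du => (lF 7%N du + lF 0%N du - lF 2%N du) * 2^-1).
  apply: eq_sdiff (sdiffM (sdiffD (sdiffD (HF (ord12 7)) (HF (ord12 0)))
    (sdiffN (HF (ord12 2)))) (sdiff_cst u0 2^-1)) _ => du /=; ring.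
apply: forall_ord12; rewrite /newton_step /=;
  repeat (match goal with |- _ /\ _ => split end);
  repeat first [exact: s0 | exact: (HF (ord12 0)) | exact: (HF (ord12 1))
    | exact: (HF (ord12 3)) | exact: (HF (ord12 4)) | exact: (HF (ord12 5))
    | exact: (HF (ord12 6)) | exact: (HF (ord12 7)) | exact: (HF (ord12 8))
    | exact: (HF (ord12 9)) | exact: (HF (ord12 10)) | exact: (HF (ord12 11))
    | apply: sdiff_var | apply: sdiffD | apply: sdiffN].
Qed.

Lemma newton_sdiff (k : 'I_12) : exists l,
  sdiff (join vfield0 vparam0)
    (fun u => (newton (fun i => u (inr i)) (fun i => u (inl i)))`_k) l /\
  forall du, (forall i, du (inl i) = 0) -> l du = 0.
Proof.
eexists; split.
  exact: (newton_step_sdiff inr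
    (F := fun j u => (normal_form_eqs (fun i => u (inr i)) (fun i => u (inl i)))`_j)
    (lF := fun j du => (normal_form_lin (fun i => du (inr i)) (fun i => du (inl i)))`_j)
    (@normal_form_sdiff _ (join vfield0 vparam0) inr inl (fun=> erefl) (fun=> erefl))).
move=> du du0; move: k; apply: forall_ord12; rewrite /newton_step /normal_form_lin /= !du0;
  by repeat (match goal with |- _ /\ _ => split end); field.
Qed.

Lemma residual_sdiff (k : 'I_12) : exists l,
  sdiff (join vparam0 vfield0)
    (fun u => (residual (fun i => u (inl i)) (fun i => u (inr i)))`_k) l /\
  forall du, (forall i, du (inl i) = 0) -> l du = 0.
Proof.
exists (fun du => du (inr k) +
  (normal_form_lin (fun i => du (inl i)) (fun i => du (inr i)))`_k); split.
  have -> : (fun u : 'I_12 + 'I_12 -> R =>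
      (residual (fun i => u (inl i)) (fun i => u (inr i)))`_k) = fun u =>
      u (inr k) + (normal_form_eqs (fun i => u (inl i)) (fun i => u (inr i)))`_k.
    by apply/funext => u; exact: residual_stepE.
  by apply: sdiffD; [exact: sdiff_var|exact: normal_form_sdiff].
move=> du du0; move: k; apply: forall_ord12; rewrite /normal_form_lin /= !du0;
  by repeat (match goal with |- _ /\ _ => split end); ring.
Qed.

End Newton.

(** * The local analytic diffeomorphism *)

Lemma near_param0 {R : realType} (p : affine R * R * 'rV[R]_5) :
  ball param0 (4^-1) p -> p.1.1.1 \in unitmx /\ 0 < p.1.2.
Proof.
have r0 : 0 < 4^-1 :> R by rewrite invr_gt0.
move=> /(param_ballP _ _ r0); rewrite param_coord0 => H.
have := (H (ord12 0), H (ord12 1), H (ord12 2), H (ord12 3), H (ord12 6)).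
rewrite /vparam0 /param_coord /= !ltr_norml.
move=> [[[[/andP[h0 h0'] /andP[h1 h1']] /andP[h2 h2']] /andP[h3 h3']] /andP[h6 h6']].
split; last by lra.
rewrite unitmxE unitfE det_mx22 gt_eqF //.
have h12 : `|p.1.1.1 0 1 * p.1.1.1 1 0| <= 4^-1 * 4^-1.
  by rewrite normrM ler_pM // ler_norml; apply/andP; split; lra.
have := ler_norm (p.1.1.1 0 1 * p.1.1.1 1 0).
(* Within 1/4 of the identity the determinant is at least 9/16 - 1/16. *)
have : 3 / 4 * (3 / 4) <= p.1.1.1 0 0 * p.1.1.1 1 1 by apply: ler_pM; lra.
lra.
Qed.

Lemma analytic_at_of_series {R : realType} {V W : normedModType R} {n m : nat}
    (cV : V -> 'I_n -> R) (oV : ('I_n -> R) -> V)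
    (cW : W -> 'I_m -> R) (oW : ('I_m -> R) -> W)
    (f : V -> W) (g : ('I_n -> R) -> 'I_m -> R) (a : V) (r s : R) :
  (forall u, cV (oV u) =1 u) -> (forall x, oV (cV x) = x) ->
  (forall k x y i, cV (k *: x + y) i = k * cV x i + cV y i) ->
  (forall u, cW (oW u) =1 u) -> (forall x, oW (cW x) = x) ->
  (forall k x y i, cW (k *: x + y) i = k * cW x i + cW y i) ->
  0 < r -> 0 < s ->
  (forall x, (forall i, `|cV a i - cV x i| < s) -> cW (f x) =1 g (cV x)) ->
  (forall j, exists (c : {ffun 'I_n -> nat} -> R) (M : R), forall t : 'rV[R]_n,
    (forall i, `|t 0 i| <= r) ->
    (forall N, box_sum (fun alpha => `|multi_power t alpha * c alpha|) N <= M)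
    /\ box_sum (fun alpha => multi_power t alpha * c alpha) @ \oo -->
       g (fun i => cV a i + t 0 i) j) ->
  analytic_at f a.
Proof.
move=> oVK cVK linV oWK cWK linW r0 s0 fg gP.
apply: (@analytic_at_coord _ _ _ _ _ f a (fun i => oV (fun j => (j == i)%:R))
  (fun i => oW (fun j => (j == i)%:R)) (fun t => g (fun i => cV a i + t 0 i))
  (Num.min r s)).
- by rewrite lt_min r0.
- exact: coord_bij oVK cVK linV.
- move=> t ts; rewrite -(coord_sum _ oVK cVK linV) -(coord_sum _ oWK cWK linW).
  have E : cV (a + oV (t 0)) =1 fun i => cV a i + t 0 i.
    by move=> i; rewrite addrC -[oV _]scale1r linV mul1r oVK addrC.
  rewrite -[LHS]cWK; congr oW; apply/funext => j.
  rewrite fg; last first.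
    move=> i; rewrite E opprD addrA subrr add0r normrN.
    by have := ts i; rewrite lt_min => /andP[].
  by congr (g _ j); apply/funext.
- move=> j; have [c [M cM]] := gP j; exists c, M => t tr; apply: cM => i.
  by have := tr i; rewrite lt_min => /andP[/ltW].
Qed.

Lemma local_normal_form (R : realType) :
  exists (G : set (affine R * R)) (Lambda0 : set 'rV[R]_5)
         (V0 : set 'M[R]_(2, 6)),
    [/\ [/\ open G, G (affine_id, 1) &
            G `<=` [set g : affine R * R | Aff2 g.1 /\ 0 < g.2]],
        open Lambda0 /\ Lambda0 0,
        open V0 /\ V0 (quad_coef (X 0)) &
        analytic_diffeo (G `*` Lambda0) V0 (@S_map R)].
Proof.
(* [g1] recovers the parameters from the field, while [g2] below recovers the field from the
   parameters. *)
have [d1 [e1 [L1 [g1 [[d10 e10 L10] [g1P g1L g1A]]]]]] :=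
  analytic_implicit_function (@newton_sdiff R)
    (proj2 (newton_stepP _ _) (@normal_form_eqs0 R)).
have [d2 [e2 [L2 [g2 [[d20 e20 L20] [g2P g2L g2A]]]]]] :=
  analytic_implicit_function (@residual_sdiff R)
    (proj2 (residual_stepP _ _) (@normal_form_eqs0 R)).
(* In this order: positivity, invertibility of the linear part, the domain of [g2], the box where
   [g1] is the only solution, and images that fall in the domain of [g1]. The denominator [1 + L2]
   stays positive when [L2] is zero. *)
have [eta [eta0 eta4 etad2 etae1 etaL]] : exists eta : R,
    [/\ 0 < eta, eta <= 4^-1, eta <= d2, eta <= e1 & L2 * eta < d1].
  have L2p : 0 < 1 + L2 by rewrite ltr_wpDr.
  exists (Num.min (Num.min 4^-1 d2) (Num.min e1 (d1 / (1 + L2) / 2))).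
  rewrite !lt_min !ge_min invr_gt0 d20 e10 ltr0n !divr_gt0 // !lexx !orbT.
  split=> //; set m := Num.min _ _.
  have : m <= d1 / (1 + L2) / 2 by rewrite !ge_min lexx !orbT.
  rewrite -mulrA -invfM ler_pdivlMr ?mulr_gt0 //.
  have m0 : 0 <= m by rewrite !le_min invr_ge0 !ltW ?divr_gt0.
  nra.
(* [g2] solves the equations, and for an invertible linear part [S_mapP] leaves only one field that
   does; so [S_map] inherits the series of [g2]. *)
have F2 p : ball param0 eta p -> S_map p = field_of (g2 (param_coord p)).
  move=> pU; have [Au _] : p.1.1.1 \in unitmx /\ 0 < p.1.2.
    by apply: near_param0; exact: le_ball pU.
  apply/esym/(S_mapP _ Au); rewrite (funext (field_ofK _)).
  apply/residual_stepP => k; move: pU => /(param_ballP _ _ eta0) pU.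
  apply: (proj2 (g2P (param_coord p) _ k)) => i.
  by rewrite distrC -param_coord0; exact: lt_le_trans (pU i) etad2.
have S2 p : ball param0 eta p -> field_coord (S_map p) = g2 (param_coord p).
  by move=> /F2 ->; apply/funext; exact: field_ofK.
have S1 p : ball param0 eta p ->
    forall k, `|field_coord (S_map p) k - vfield0 k| < d1.
  move=> pU k; rewrite S2 //; apply: le_lt_trans etaL.
  move: pU => /(param_ballP _ _ eta0) pU.
  apply: (g2L _ (@vparam0 R)) => [|i|i|i|j|j].
  - exact: ltW.
  - by rewrite distrC -param_coord0; exact: lt_le_trans (pU i) etad2.
  - by rewrite subrr normr0.
  - by rewrite distrC -param_coord0 ltW.
  - by rewrite subrr normr0 ltW.
  - exact: (proj2 (residual_stepP _ _) (@normal_form_eqs0 R)).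
have unitU p : ball param0 eta p -> p.1.1.1 \in unitmx /\ 0 < p.1.2.
  by move=> pU; apply: near_param0; exact: le_ball pU.
have newtonS p : ball param0 eta p -> forall k : 'I_12,
    (newton (param_coord p) (field_coord (S_map p)))`_k = param_coord p k.
  move=> pU; have [Au _] := unitU _ pU.
  exact: (proj2 (newton_stepP _ _) (proj1 (S_mapP _ Au) erefl)).
have e1U p : ball param0 eta p -> forall j, `|param_coord p j - vparam0 j| <= e1.
  move=> /(param_ballP _ _ eta0) pU j; rewrite distrC -param_coord0.
  by apply: le_trans etae1; exact: ltW.
pose g Y := param_of (g1 (field_coord Y)).
have gS p : ball param0 eta p -> g (S_map p) = p.
  move=> pU; rewrite /g -[RHS]param_coordK; congr param_of; apply/funext => k.
  apply/eqP; rewrite -subr_eq0 -normr_le0 -(mulr0 L1).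
  (* Uniqueness over a single field: [p] itself is a fixed point of the Newton map close to the base
     point. *)
  apply: (g1L _ (field_coord (S_map p)) _ 0) => [|i|i|i|j|j].
  - exact: lexx.
  - exact: S1.
  - exact: S1.
  - by rewrite subrr normr0.
  - exact: e1U.
  - exact: newtonS.
have Sg Y : (forall i, `|field_coord Y i - vfield0 i| < d1) ->
    ball param0 eta (g Y) -> S_map (g Y) = Y.
  move=> Yd gU; have [Au _] := unitU _ gU; apply/esym/(S_mapP _ Au).
  rewrite /g (funext (param_ofK _)); apply/(newton_stepP (g1 (field_coord Y))) => k.
  exact: (proj2 (g1P _ Yd k)).
have openU (p : affine R * R * 'rV[R]_5) : ball param0 eta p ->
    exists2 s : R, 0 < s & ball p s `<=` ball param0 eta.
  move=> pU; have : nbhs p (ball param0 eta).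
    by apply: open_nbhs_nbhs; split=> //; exact: ball_open.
  by move=> /nbhs_ballP[s s0 sU]; exists s.
have openV (Y : 'M[R]_(2, 6)) : (forall i, `|field_coord Y i - vfield0 i| < d1) ->
    exists2 s : R, 0 < s & forall Z, ball Y s Z ->
      forall i, `|field_coord Z i - vfield0 i| < d1.
  rewrite -field_coord0 => Yd; have : nbhs Y (ball (quad_coef (X 0)) d1).
    apply: open_nbhs_nbhs; split; first exact: ball_open.
    by apply/(field_ballP _ _ d10) => k; rewrite distrC.
  move=> /nbhs_ballP[s s0 sU]; exists s => // Z /sU /(field_ballP _ _ d10) Zd i.
  by rewrite distrC.
have U0 : ball param0 eta param0 by exact: ballxx.
have UE : ball ((affine_id, 1) : affine R * R) eta `*` ball (0 : 'rV[R]_5) eta =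
  ball param0 eta by [].
exists (ball ((affine_id, 1) : affine R * R) eta), (ball (0 : 'rV[R]_5) eta),
  (@S_map R @` ball param0 eta).
(* A field [Z] near [S_map p] is the image of [g Z], which the Lipschitz bound on [g1] keeps near
   [p = g (S_map p)], hence in the ball. *)
have oV : open (@S_map R @` ball param0 eta).
  rewrite openE => _ [p pU <-]; apply/nbhs_ballP.
  have [s1 s10 s1U] := openU _ pU; have [s2 s20 s2V] := openV _ (S1 _ pU).
  have L1p : 0 < 1 + L1 by rewrite ltr_wpDr.
  have r0 : 0 < Num.min s2 (s1 / (1 + L1)) by rewrite lt_min s20 divr_gt0.
  exists (Num.min s2 (s1 / (1 + L1))) => // Z ZS.
  have Zd : forall i, `|field_coord Z i - vfield0 i| < d1.
    by apply: s2V; apply: le_ball ZS; rewrite ge_min lexx.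
  have gU : ball param0 eta (g Z).
    apply: s1U; apply/(param_ballP _ _ s10) => k.
    rewrite distrC (param_ofK _ k).
    apply: (@le_lt_trans _ _ (L1 * (s1 / (1 + L1)))); last first.
      by rewrite mulrCA gtr_pMr // ltr_pdivrMr // mul1r ltrDr.
    apply: (g1L _ (field_coord (S_map p))) => [|i|i|i|j|j].
    - by rewrite ltW // divr_gt0.
    - exact: Zd.
    - exact: S1.
    - move: ZS => /(field_ballP _ _ r0) /(_ i); rewrite lt_min => /andP[_].
      by rewrite distrC => /ltW.
    - exact: e1U.
    - exact: newtonS.
  by exists (g Z) => //; exact: Sg.
split.
- split; [exact: ball_open|exact: ballxx|] => -[Phi rho] gU.
  exact: (unitU (Phi, rho, 0) (conj gU (ballxx _ eta0))).
- by split; [exact: ball_open|exact: ballxx].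
- split=> //; exists param0 => //.
  rewrite /S_map; congr quad_coef; apply/funext => z.
  rewrite /represented /pullback /affine_map /=.
  by rewrite invmx1 !mul1mx addr0 scale1r.
rewrite UE; split=> //.
- exact: ball_open.
- split=> [p pU|p q /set_mem pU /set_mem qU pq|//].
    by exists p.
  by rewrite -(gS p) // pq gS.
- move=> p pU; have [s s0 sU] := openU _ pU.
  have pd : forall i, `|param_coord p i - vparam0 i| < d2.
    move: pU => /(param_ballP _ _ eta0) pU i; rewrite distrC -param_coord0.
    exact: lt_le_trans (pU i) etad2.
  have [r r0 gA] := g2A _ pd.
  apply: (@analytic_at_of_series R (affine R * R * 'rV[R]_5)%type 'M[R]_(2, 6)
    12 12 param_coord param_of field_coord field_of (@S_map R) g2 p r s
    param_ofK param_coordK param_coord_linear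
    field_ofK field_coordK field_coord_linear r0 s0 _ gA) => q pq k.
  by rewrite S2 //; apply: sU; apply/(param_ballP _ _ s0).
- exists g; split=> [_ [p pU <-]|//].
  have [r r0 gA] := g1A _ (S1 _ pU).
  apply: (@analytic_at_of_series R 'M[R]_(2, 6) (affine R * R * 'rV[R]_5)%type
    12 12 field_coord field_of param_coord param_of g g1 (S_map p) r 1
    field_ofK field_coordK field_coord_linear
    param_ofK param_coordK param_coord_linear r0 ltr01 _ gA) => Y _.
  exact: param_ofK.
Qed.

(** * Transport of periodic orbits *)

Section Transport.
Context {R : realType}.
Implicit Types (A : 'M[R]_2) (Phi : affine R) (F G : 'cV[R]_2 -> 'cV[R]_2)
  (gamma sigma : R -> 'cV[R]_2) (C : set (R -> 'cV[R]_2)) (z : 'cV[R]_2).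

Lemma mulmx2_colE A z : A *m z = z 0 0 *: col 0 A + z 1 0 *: col 1 A.
Proof.
apply/matrixP => i j; rewrite (ord1 j) !mxE !big_ord_recl big_ord0 addr0.
rewrite [z 0 0 * _]mulrC [z 1 0 * _]mulrC.
by congr (_ + A i _ * z _ 0); exact/val_inj.
Qed.

Lemma cvg_mulmx2 {T : Type} (Fl : set_system T) {FF : Filter Fl} A
    (q : T -> 'cV[R]_2) l :
  q @ Fl --> l -> (fun h => A *m q h) @ Fl --> A *m l.
Proof.
move=> ql; have E i : (fun h => q h i 0) @ Fl --> l i 0.
  exact: (cvg_comp _ _ ql (@coord_continuous R 2 1 i 0 l)).
rewrite mulmx2_colE; under eq_fun do rewrite mulmx2_colE.
by apply: cvgD; exact: cvgZr_tmp.
Qed.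

Lemma norm_mulmx2_le A : exists2 K : R, 0 <= K & forall z, `|A *m z| <= K * `|z|.
Proof.
exists (`|col 0 A| + `|col 1 A|) => [|z]; first by rewrite addr_ge0.
have E i : `|z i 0| <= `|z|.
  rewrite [leRHS]/Num.norm /= mx_normrE.
  exact: (le_bigmax _ (fun ij : 'I_2 * 'I_1 => `|z ij.1 ij.2|) (i, 0)).
rewrite mulmx2_colE; apply: le_trans (ler_normD _ _) _; rewrite !normrZ.
by rewrite mulrDl lerD // mulrC ler_wpM2l.
Qed.

Lemma box_sum_pred1 {W : normedModType R} n (b : W) N : (0 < N)%N ->
  box_sum (fun alpha : {ffun 'I_n -> nat} => if alpha == [ffun=> 0%N] then b else 0) N = b.
Proof.
move=> N0; rewrite box_sumE -big_mkcond /= -big_filter.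
rewrite (@eq_filter _ _ (pred1 [ffun=> 0%N])) // filter_pred1_uniq ?box_uniq //.
  by rewrite big_seq1.
by rewrite mem_box; apply/forallP => i; rewrite ffunE.
Qed.

(** The linear part acts on each coefficient, and the translation changes only the constant one. *)
Lemma analytic_affine Phi sigma s :
  analytic_at sigma s -> analytic_at (affine_map Phi \o sigma) s.
Proof.
case: Phi => A b [n [e [c [r [ebij r0 cP]]]]].
pose z0 : {ffun 'I_n -> nat} := [ffun=> 0%N].
pose d alpha : 'cV[R]_2 := if alpha == z0 then b else 0.
have mpd t alpha : multi_power t alpha *: d alpha = d alpha.
  rewrite /d; case: eqP => [->|_]; last by rewrite scaler0.
  by rewrite multi_power0 scale1r.
exists n, e, (fun alpha => A *m c alpha + d alpha), r; split=> // t tr.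
have [h1 h2] := cP t tr; have [K K0 KP] := norm_mulmx2_le A; split.
  set a := fun alpha => `|multi_power t alpha *: c alpha|.
  apply: (@box_sum_cvg _ _ _ (K * limn (box_sum a) + `|b|)) => // N.
  apply: (@le_trans _ _ (K * box_sum a N +
      box_sum (fun alpha => if alpha == z0 then `|b| else 0) N)).
    rewrite /box_sum mulr_sumr -big_split /=; apply: ler_sum => k _.
    rewrite scalerDr mpd scalemxAr; apply: le_trans (ler_normD _ _) _.
    by rewrite lerD // /d; case: ifP; rewrite ?normr0.
  apply: lerD.
    by rewrite ler_wpM2l //; apply: nondecreasing_cvgn_le => //;
      apply: box_sum_nondecreasing => ?; rewrite normr_ge0.
  (* The box of size 0 can miss the zero exponent, so the comparison goes through the next box. *)
  have le0 : box_sum (fun alpha => if alpha == z0 then `|b| else 0) N <=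
     box_sum (fun alpha => if alpha == z0 then `|b| else 0) N.+1.
    by apply: box_sum_nondecreasing => // alpha; case: ifP.
  by apply: le_trans le0 _; rewrite box_sum_pred1.
have -> : box_sum (fun alpha => multi_power t alpha *: (A *m c alpha + d alpha)) =
    (fun N => A *m box_sum (fun alpha => multi_power t alpha *: c alpha) N +
       box_sum d N).
  apply/funext => N; rewrite /box_sum mulmx_sumr -big_split /=.
  by apply: eq_bigr => k _; rewrite scalerDr mpd scalemxAr.
rewrite /= /affine_map /=; apply: cvgD; first exact: cvg_mulmx2.
apply: (cvg_trans _ (@cvg_cst _ b _ (\oo : set_system nat) _)).
apply: near_eq_cvg; near=> N; rewrite box_sum_pred1 //.
by near: N; exact: nbhs_infty_gt.
Unshelve. all: by end_near. Qed.

Definition affine_inv Phi : affine R :=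
  (invmx Phi.1, - (invmx Phi.1 *m Phi.2)).

Lemma affine_mapK Phi : Phi.1 \in unitmx ->
  cancel (affine_map Phi) (affine_map (affine_inv Phi)).
Proof.
by move=> Au z; rewrite /affine_map /= mulmxDr mulKmx // addrK.
Qed.

Lemma affine_invK Phi : Phi.1 \in unitmx ->
  cancel (affine_map (affine_inv Phi)) (affine_map Phi).
Proof.
by move=> Au z; rewrite /affine_map /= mulmxDr mulmxN !mulKVmx // subrK.
Qed.

(* F = rho Phi^* G *)
Definition conjugated Phi (rho : R) F G :=
  [/\ Phi.1 \in unitmx, 0 < rho & forall z, Phi.1 *m F z = rho *: G (affine_map Phi z)].

Lemma conjugated_sym Phi rho F G : conjugated Phi rho F G ->
  conjugated (affine_inv Phi) rho^-1 G F.
Proof.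
move=> [Au r0 FG]; split; rewrite ?unitmx_inv ?invr_gt0 // => z.
apply: (can_inj (mulKmx Au)); rewrite mulKVmx // -scalemxAr FG affine_invK //.
by rewrite scalerA mulVf ?scale1r // gt_eqF.
Qed.

Lemma cvg_dnbhs_scale (c : R) : c != 0 -> (fun h : R => h * c) @ 0^' --> 0^'.
Proof.
move=> c0 P /nbhs_ballP[e e0 eP]; apply/nbhs_ballP.
exists (e / `|c|); first by rewrite /= divr_gt0 ?normr_gt0.
move=> h; rewrite /ball /= sub0r normrN ltr_pdivlMr ?normr_gt0 // => he h0.
apply: eP; last by rewrite mulf_neq0.
by rewrite /ball /= sub0r normrN normrM.
Qed.

Lemma is_derive_affine Phi gamma (c t : R) v : c != 0 ->
  is_derive (t * c) 1 gamma v ->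
  is_derive t 1 (fun s => affine_map Phi (gamma (s * c))) (c *: (Phi.1 *m v)).
Proof.
move=> c0 [dg vE]; rewrite -vE scalemxAr.
have : (fun h : R => h^-1 *: (gamma (h *: 1 + t * c) - gamma (t * c))) @ 0^' -->
   'D_1 gamma (t * c) by exact: dg.
move=> /(cvg_comp _ _ (cvg_dnbhs_scale c0)) /(cvgZl_tmp (k := c)).
move=> /(cvg_mulmx2 (A := Phi.1)) H.
suff H' : (fun h : R => h^-1 *: (affine_map Phi (gamma ((h *: 1 + t) * c)) -
    affine_map Phi (gamma (t * c)))) @ 0^' --> Phi.1 *m (c *: 'D_1 gamma (t * c)).
  by split; [exact: cvgP H'|exact: cvg_lim H'].
apply: cvg_trans H; apply: near_eq_cvg; near=> h.
have h0 : h != 0 by near: h; exact: nbhs_dnbhs_neq.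
rewrite /= !scalerA invfM mulrA mulrAC mulfV // mul1r -scalemxAr mulmxBr.
rewrite /affine_map opprD addrACA subrr addr0.
by rewrite -![_ *: 1]/(_ * 1) !mulr1 mulrDl.
Unshelve. all: by end_near. Qed.

(** No differentiability of [sigma] is assumed: invertibility makes the two difference quotients
    converge or diverge together. *)
Lemma derive1_affine Phi sigma s : Phi.1 \in unitmx ->
  derive1 (affine_map Phi \o sigma) s = Phi.1 *m derive1 sigma s.
Proof.
move=> Au; rewrite /derive1.
set q := fun h : R => h^-1 *: (sigma (h + s) - sigma s).
have -> : (fun h : R => h^-1 *: ((affine_map Phi \o sigma) (h + s) -
    (affine_map Phi \o sigma) s)) = fun h => Phi.1 *m q h.
  apply/funext => h; rewrite /q /= -scalemxAr mulmxBr /affine_map.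
  by rewrite opprD addrACA subrr addr0.
have [cq|dq] := pselect (cvg (q @ 0^')).
  by apply: cvg_lim => //; exact: cvg_mulmx2.
(* In the divergent case both derivatives are the default value of the limit, which is zero and thus
   fixed by the matrix. *)
have p0 : point = 0 :> 'cV[R]_2 by apply/matrixP => i j; rewrite !mxE.
rewrite (dvgP dq) dvgP; first by rewrite [X in _ *m X]p0 mulmx0.
move=> /(cvg_mulmx2 (A := invmx Phi.1)) H; apply: dq.
have E : q = fun h => invmx Phi.1 *m (Phi.1 *m q h).
  by apply/funext => h; rewrite mulKmx.
by rewrite E; exact: (cvgP _ H).
Qed.

Lemma det_row_mx2 (u v : 'cV[R]_2) :
  \det (row_mx u v : 'M[R]_2) = u 0 0 * v 1 0 - u 1 0 * v 0 0.
Proof.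
rewrite det_mx22.
have e0 i : (row_mx u v : 'M[R]_2) i 0 = u i 0.
  by rewrite mxE; case: splitP => // j _; rewrite (ord1 j).
have e1 i : (row_mx u v : 'M[R]_2) i 1 = v i 0.
  by rewrite mxE; case: splitP => j; rewrite (ord1 j).
by rewrite !e0 !e1; ring.
Qed.

Lemma det_row_mulmx2 A (u v : 'cV[R]_2) :
  \det (row_mx (A *m u) (A *m v) : 'M[R]_2) = \det A * \det (row_mx u v : 'M[R]_2).
Proof. by rewrite !det_row_mx2 det_mx22 !mulmx2E; ring. Qed.

End Transport.

(** * Orbits, sections and first returns under conjugacy *)

Section Orbits.
Context {R : realType}.
Implicit Types (Phi : affine R) (F G : 'cV[R]_2 -> 'cV[R]_2)
  (gamma sigma : R -> 'cV[R]_2) (C : set (R -> 'cV[R]_2)) (z : 'cV[R]_2).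

Lemma solution_conjugated Phi rho F G (D : set R) gamma :
  conjugated Phi rho F G -> solution_on F D gamma ->
  solution_on G [set t | D (t * rho^-1)]
    (fun t => affine_map Phi (gamma (t * rho^-1))).
Proof.
move=> [Au r0 FG] sg t Dt; have r1 : rho != 0 by rewrite gt_eqF.
have := is_derive_affine Phi (invr_neq0 r1) (sg _ Dt).
by rewrite FG scalerA mulVf ?scale1r.
Qed.

(** Rescaling time by a positive factor is an increasing homeomorphism, so the class of
    parametrizations absorbs it. *)
Lemma oriented_curve_affine Phi rho gamma : 0 < rho ->
  map_curve Phi (oriented_curve gamma) =
  oriented_curve (fun t => affine_map Phi (gamma (t * rho^-1))).
Proof.
move=> r0; have r1 : rho != 0 by rewrite gt_eqF.
apply/seteqP; split=> [_ [_ [h [hh hs] <-] <-]|_ [h [hh hs] <-]].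
  exists (fun s => h s * rho); last by apply/funext => s /=; rewrite mulfK.
  split=> [s t st|u]; first by rewrite ltr_pM2r // hh.
  by have [s hsu] := hs (u / rho); exists s; rewrite hsu divfK.
exists (gamma \o (fun s => h s / rho)) => //.
exists (fun s => h s / rho) => //.
split=> [s t st|u]; first by rewrite ltr_pM2r ?invr_gt0 // hh.
by have [s hsu] := hs (u * rho); exists s; rewrite hsu mulfK.
Qed.

Lemma map_curveK Phi : Phi.1 \in unitmx ->
  cancel (map_curve Phi) (map_curve (affine_inv Phi)).
Proof.
move=> Au C; apply/seteqP; split=> [_ [_ [gamma Cg <-] <-]|gamma Cg].
  suff -> : affine_map (affine_inv Phi) \o (affine_map Phi \o gamma) = gamma by [].
  by apply/funext => t /=; rewrite affine_mapK.
exists (affine_map Phi \o gamma); first by exists gamma.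
by apply/funext => t /=; rewrite affine_mapK.
Qed.

Lemma periodic_orbit_conjugated Phi rho F G C :
  conjugated Phi rho F G -> oriented_periodic_orbit F C ->
  oriented_periodic_orbit G (map_curve Phi C).
Proof.
move=> FG [gamma [sg [T [T0 gT]] [t gt]] ->]; have [Au r0 _] := FG.
have r1 : rho != 0 by rewrite gt_eqF.
exists (fun t => affine_map Phi (gamma (t * rho^-1))); last first.
  exact: oriented_curve_affine.
split; first by move=> s _; exact: (solution_conjugated FG sg).
- exists (T * rho); split; first exact: mulr_gt0.
  by move=> s; rewrite mulrDl mulfK // gT.
- exists (t * rho); rewrite mulfK // mul0r => /(can_inj (affine_mapK Au)).
  exact: gt.
Qed.

Lemma multiplicity_conjugated Phi rho F G C m :
  conjugated Phi rho F G -> orbit_multiplicity F C m ->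
  orbit_multiplicity G (map_curve Phi C) m.
Proof.
move=> FG [sigma [d [P [[d0 [sA sI sT]] [gamma Cg gs] Pan ret van]]]].
have [Au r0 FGE] := FG; have r1 : rho != 0 by rewrite gt_eqF.
have Pinj := can_inj (affine_mapK Au).
exists (affine_map Phi \o sigma), d, P; split=> //.
- split=> //; split.
  + by move=> s /sA; exact: analytic_affine.
  + by move=> s t sd td /Pinj; exact: sI.
  + move=> s sd; rewrite derive1_affine //.
    have -> : G ((affine_map Phi \o sigma) s) = Phi.1 *m (rho^-1 *: F (sigma s)).
      by rewrite -scalemxAr FGE scalerA mulVf // scale1r.
    rewrite det_row_mulmx2 mulf_neq0 //; first by rewrite -unitfE -unitmxE.
    have -> : \det (row_mx (derive1 sigma s) (rho^-1 *: F (sigma s)) : 'M[R]_2) =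
        rho^-1 * \det (row_mx (derive1 sigma s) (F (sigma s)) : 'M[R]_2).
      by rewrite !det_row_mx2 !mxE; ring.
    by rewrite mulf_neq0 ?invr_neq0 // sT.
- exists (affine_map Phi \o gamma); first by exists gamma.
  by case: gs => t _ gt; exists t => //=; rewrite gt.
- apply: filterS ret => s [tau [phi [tau0 sphi phi0 phit [[u ud us] phin]]]].
  (* Only the return time changes; the point of return keeps its coordinate on the section. *)
  exists (tau * rho), (fun t => affine_map Phi (phi (t * rho^-1))); split.
  + exact: mulr_gt0.
  + move=> t; rewrite /= in_itv /= => /andP[t0 tt].
    apply: (solution_conjugated FG sphi); rewrite /= in_itv /=.
    by rewrite divr_ge0 ?(ltW r0) //= ler_pdivrMr.
  + by rewrite mul0r phi0.
  + by rewrite mulfK // phit.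
  + split; first by exists u => //=; rewrite us.
    (* By injectivity of the affine map, an earlier crossing of the image section would be an
       earlier crossing of the original one. *)
    move=> t /andP[t0 tt] [v vd /= /Pinj vE]; apply: (phin (t / rho)).
      by rewrite divr_gt0 //= ltr_pdivrMr.
    by exists v.
Qed.

End Orbits.

Lemma represented_conjugated {R : realType} (Phi : affine R) (rho : R)
    (lambda : 'rV[R]_5) : Aff2 Phi -> 0 < rho ->
  conjugated Phi rho (represented (Phi, rho, lambda)) (X lambda).
Proof.
move=> Au r0; split=> // z.
by rewrite /represented /pullback /= -scalemxAr mulKVmx.
Qed.

Theorem proposition1 (R : realType) :
  exists (G : set (affine R * R)) (Lambda0 : set 'rV[R]_5)
         (V0 : set 'M[R]_(2, 6)),
    [/\ [/\ open G, G (affine_id, 1) &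
            G `<=` [set g : affine R * R | Aff2 g.1 /\ 0 < g.2]],
        open Lambda0 /\ Lambda0 0,
        open V0 /\ V0 (quad_coef (X 0)),
        analytic_diffeo (G `*` Lambda0) V0 (@S_map R) /\
        (forall Y : 'M[R]_(2, 6), V0 Y ->
           exists! p : affine R * R * 'rV[R]_5,
             (G `*` Lambda0) p /\ quad_field Y = represented p) &
        forall (Phi : affine R) (rho : R) (lambda : 'rV[R]_5),
          G (Phi, rho) -> Lambda0 lambda ->
          forall C : set (R -> 'cV[R]_2),
            (oriented_periodic_orbit (represented (Phi, rho, lambda)) C <->
             oriented_periodic_orbit (X lambda) (map_curve Phi C)) /\
            (oriented_periodic_orbit (represented (Phi, rho, lambda)) C ->
             forall m : option nat,
               orbit_multiplicity (represented (Phi, rho, lambda)) C m <->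
               orbit_multiplicity (X lambda) (map_curve Phi C) m)].
Proof.
have [G [L [V [[oG G1 GA] L0 V0 SD]]]] := local_normal_form R.
have [_ _ [Sfun Sinj Ssurj] _ _] := SD.
exists G, L, V; split=> //.
  split=> // Y VY; have [p pU pY] := Ssurj _ VY.
  exists p; split=> [|q [qU qY]]; first by rewrite -quad_field_S_map pY.
  (* Two representations of the same field have the same coefficients, so uniqueness is injectivity
     of [S_map]. *)
  apply: Sinj; rewrite ?inE //; rewrite pY; apply: (can_inj (@quad_coefK R)).
  by rewrite quad_field_S_map qY.
move=> Phi rho lambda GPhi Ll C; have [Au r0] := GA _ GPhi.
have FG := represented_conjugated lambda Au r0.
(* Each converse is the direct implication for the inverse conjugacy, applied to the image curve and
   brought back by this cancellation. *)
have CK : map_curve (affine_inv Phi) (map_curve Phi C) = C by exact: map_curveK.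
split=> [|_ m]; split=> h.
- exact: periodic_orbit_conjugated FG h.
- by rewrite -CK; exact: periodic_orbit_conjugated (conjugated_sym FG) h.
- exact: multiplicity_conjugated FG h.
- by rewrite -CK; exact: multiplicity_conjugated (conjugated_sym FG) h.
Qed.
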